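(* Let $(X,d,\mu)$ be a complete metric space equipped with a doubling Borel measure $\mu$, and suppose that $X$ satisfies an annular decay property. Then $$A_1(X)=\{w\in A_\infty(X):\ \log w\in BLO(X)\}$$ and $$RH_\infty(X)=\{w:\ w \text{ is a weight on } X \text{ and } \log w\in BUO(X)\}.$$
   Context: Balls $B=B(x,r)$ are open, and $2B=B(x,2r)$. The measure $\mu$ is doubling: there is $C_d>1$ such that $0<\mu(2B)\le C_d\,\mu(B)<\infty$ for all balls $B\subset X$. Write $\frac{1}{\mu(B)}\int_B f\,d\mu$ for the average of $f$ over $B$. $L^1_{\mathrm{loc}}(X)$ is the set of functions integrable on every compact subset of $X$. Annular decay property: for some $0<\alpha\le 1$ there is $C\ge 1$ such that for every $x\in X$, $r>0$ and $0<\delta<1$, $\mu(B(x,r)\setminus B(x,(1-\delta)r))\le C\delta^\alpha\mu(B(x,r))$. A weight is a nonnegative function $w\in L^1_{\mathrm{loc}}(X)$ with $w>0$ $\mu$-a.e.; members of the classes below are weights. $w\in A_1(X)$ if there is a constant $C<\infty$ with $\frac{1}{\mu(B)}\int_B w\,d\mu\le C\,\operatorname{ess\,inf}_B w$ for every ball $B\subset X$. $w\in A_\infty(X)$ if $\sup_{B}\left(\frac{1}{\mu(B)}\int_B w\,d\mu\right)\exp\left(-\frac{1}{\mu(B)}\int_B\log w\,d\mu\right)<\infty$, the supremum being over all balls $B\subset X$. $w\in RH_\infty(X)$ if there is a constant $C<\infty$ with $\operatorname{ess\,sup}_B w\le C\,\frac{1}{\mu(B)}\int_B w\,d\mu$ for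 every ball $B\subset X$. $f\in L^1_{\mathrm{loc}}(X)$ belongs to $BLO(X)$ if $\sup_B\left(\frac{1}{\mu(B)}\int_B f\,d\mu-\operatorname{ess\,inf}_B f\right)<\infty$, and to $BUO(X)$ if $\sup_B\left(\operatorname{ess\,sup}_B f-\frac{1}{\mu(B)}\int_B f\,d\mu\right)<\infty$, suprema over all balls $B\subset X$. *)

(* Defs.v *)
From HB Require Import structures.
From mathcomp Require Import all_boot all_order all_algebra.
From mathcomp Require Import all_classical all_reals all_analysis. 
From mathcomp Require Import ess_sup_inf.
Import Order.TTheory GRing.Theory Num.Theory.
Import numFieldNormedType.Exports.
Set Implicit Arguments.
Unset Strict Implicit.
Unset Printing Implicit Defensive.
Local Open Scope classical_set_scope.
Local Open Scope ring_scope.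

#[short(type="completeMetricType")]
HB.structure Definition CompleteMetric (K : numDomainType) :=
  {M of Metric K M & Complete M}.

(* The underlying set of X equipped with its Borel sigma-algebra. *)
Notation borelType X := (g_sigma_algebraType (@open X)).

Section measurable_ball.
Context {R : realType} {X : completeMetricType R}.

Lemma metric_ball_open (x : X) (r : R) : open (ball x r).
Proof.
rewrite openE => y; rewrite ballEmdist/= => xyr.
apply/nbhs_ballP; exists (r - mdist x y); first by rewrite /= subr_gt0.
move=> z; rewrite !ballEmdist/= => yz.
by rewrite (le_lt_trans (metric_triangle x y z))// -ltrBrDl.
Qed.

Lemma measurable_mball (x : X) (r : R) :
  measurable (ball x r : set (borelType X)).
Proof. by apply: sub_sigma_algebra; exact: metric_ball_open. Qed.

End measurable_ball.

Section weight_classes.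
Context {R : realType} {X : completeMetricType R}.
Variable mu : {measure set (borelType X) -> \bar R}.
Implicit Types (f w : X -> R) (x : X) (r : R).
Local Open Scope ereal_scope.

Definition doubling := exists2 C : R, (1 < C)%R &
  forall x r, (0 < r)%R ->
    [/\ 0 < mu (ball x (2 * r)%R),
        mu (ball x (2 * r)%R) <= C%:E * mu (ball x r) &
        C%:E * mu (ball x r) < +oo].

Definition annular_decay := exists alpha C : R,
  [/\ (0 < alpha <= 1)%R, (1 <= C)%R &
      forall x r (delta : R), (0 < r)%R -> (0 < delta < 1)%R ->
        mu (ball x r `\` ball x ((1 - delta) * r)%R)
          <= (C * delta `^ alpha)%:E * mu (ball x r)].

(* Integrals are taken in \bar R, so that for a function whose integral over
   the ball diverges to -oo the average is -oo. *)
Definition avg x r f :=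
  (mu (ball x r))^-1 * \int[mu]_(y in ball x r) (f y)%:E.

Definition ess_sup_ball x r f :=
  ess_sup (mrestr mu (measurable_mball x r)) (EFin \o f).

Definition ess_inf_ball x r f :=
  ess_inf (mrestr mu (measurable_mball x r)) (EFin \o f).

Definition L1loc : set (X -> R) :=
  [set f | forall K : set X, compact K -> mu.-integrable K (EFin \o f)].

Definition weight : set (X -> R) :=
  [set w | [/\ forall x, (0 <= w x)%R, L1loc w &
               {ae mu, forall x, (0 < w x)%R}]].

(* The logarithm of a weight; [ln 0 = 0] is only used on a null set. *)
Definition log w : X -> R := fun x => ln (w x).

Definition A1 : set (X -> R) :=
  [set w | weight w /\ exists C : R, forall x r, (0 < r)%R ->
     avg x r w <= C%:E * ess_inf_ball x r w].

(* If [log w] has average -oo over some ball then the supremum is +oo, as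
   [expeR +oo = +oo]. *)
Definition Ainfty : set (X -> R) :=
  [set w | weight w /\
     ereal_sup [set s | exists x r, (0 < r)%R /\
        s = avg x r w * expeR (- avg x r (log w))] < +oo].

Definition RHinfty : set (X -> R) :=
  [set w | weight w /\ exists C : R, forall x r, (0 < r)%R ->
     ess_sup_ball x r w <= C%:E * avg x r w].

Definition BLO : set (X -> R) :=
  [set f | L1loc f /\
     ereal_sup [set s | exists x r, (0 < r)%R /\
        s = avg x r f - ess_inf_ball x r f] < +oo].

Definition BUO : set (X -> R) :=
  [set f | L1loc f /\
     ereal_sup [set s | exists x r, (0 < r)%R /\
        s = ess_sup_ball x r f - avg x r f] < +oo].

End weight_classes.

(* Main.v *)
Require Import Defs.
From HB Require Import structures.
From mathcomp Require Import all_boot all_order all_algebra.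
From mathcomp Require Import all_classical all_reals all_analysis.
From mathcomp Require Import measurable_realfun ess_sup_inf.
From mathcomp Require Import lra.
Import Order.TTheory GRing.Theory Num.Theory.
Import numFieldNormedType.Exports.
Set Implicit Arguments.
Unset Strict Implicit.
Unset Printing Implicit Defensive.
Local Open Scope classical_set_scope.
Local Open Scope ring_scope.

(* The statement on A_1, and the inclusion from BUO to RH_oo, only need the
   inequality [mean (log w) <= log (mean w)]; the substance is that RH_oo implies
   that [log w] is locally integrable, with average at least [log (mean w) - K].
   RH_oo bounds [w(A) / w(B)] by a multiple of [mu(A) / mu(B)], so annular decay makes
   [w dmu] doubling.  To estimate the sublevel set [w < l] in a ball, cover a
   compact part of it by stopping balls on which [mean w] first drops below
   [kap * l].  By doubling the mean there is comparable to [kap * l], so by RH_oo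
   [w < Lam * l] a.e. on each such ball while [l <= w] on a fixed proportion of it.
   After a Vitali selection, passing from level [Lam * l] to level [l] loses a
   fixed proportion of the measure; iterating gives geometric decay of the
   sublevel sets, hence integrability of [log w].  Points at which the mean never
   drops form a negligible part: there small balls satisfy [w(B) > kap * l * mu(B)],
   which regularity of [mu] excludes.  As stopping at height [l] forces small radii,
   the ambient radii can shrink geometrically during the iteration, keeping the
   stopping balls inside. *)

(** * Coverings in metric spaces *)

Section metric_space.
Context {R : realType} {X : completeMetricType R}.
Implicit Types (x y z : X) (r : R) (A K U : set X).

Lemma in_ball x y r : ball x r y <-> mdist x y < r.
Proof. by rewrite ballEmdist. Qed.

Lemma ball_subset x y r r' : mdist x y + r <= r' -> ball y r `<=` ball x r'.
Proof.
move=> h z /in_ball yz; apply/in_ball.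
by rewrite (le_lt_trans (metric_triangle x y z))// (lt_le_trans _ h)// ltrD2l.
Qed.

(** An ultrafilter containing a finite union of balls contains one of them. Total boundedness thus
    makes every ultrafilter on [A] Cauchy, and completeness makes it converge. *)
Lemma totally_bounded_compact A : closed A ->
  (forall e, 0 < e -> exists s : seq X,
     forall y, A y -> exists2 p, p \in s & ball p e y) ->
  compact A.
Proof.
move=> clA tb; rewrite compact_ultra => F UF FA.
have : cauchy F.
  apply: cauchy_exP => e e0; have [s As] := tb e e0.
  have : F [set y | exists2 p, p \in s & ball p e y] by exact: filterS FA.
  elim: s {As} => [|p s IH] Fs.
    have F0 : F set0 by apply: filterS Fs => y [].
    by have := filter_ex F0 => -[].
  have [Fp|FNp] := in_ultra_setVsetC (ball p e) UF; first by exists p.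
  apply: IH; apply: filterS (filterI Fs FNp) => y [[q]].
  by rewrite inE => /predU1P[->//|qs qy] _; exists q.
move=> /cauchy_cvg/cvg_ex[l Fl].
exists l; split=> //; apply: clA => B /Fl FB.
exact: filter_ex (filterI FA FB).
Qed.

(** If no finite family covers, the uncovered parts of [K] generate a proper filter. At a cluster
    point [p], the ball about [p] would have to meet its own complement. *)
Lemma compact_finite_cover K (r : X -> R) : compact K ->
  (forall y, K y -> 0 < r y) ->
  exists s : seq X, (forall y, y \in s -> K y) /\
    forall z, K z -> exists2 y, y \in s & ball y (r y) z.
Proof.
move=> cK r0; apply: contrapT => /forallNP noS.
pose D := [set s : seq X | forall y, y \in s -> K y].
pose B (s : seq X) := K `&` [set z | forall y, y \in s -> ~ ball y (r y) z].
have FF : ProperFilter (filter_from D B).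
  apply: filter_from_proper.
    apply: filter_from_filter; first by exists [::].
    move=> s t Ds Dt; exists (s ++ t).
      by move=> y; rewrite mem_cat => /orP[/Ds|/Dt].
    by move=> z [Kz h]; split; split=> // y ys; apply: h;
       rewrite mem_cat ys ?orbT.
  move=> s Ds; apply: contrapT => B0; apply: (noS s); split=> // z Kz.
  apply: contrapT => h; apply: B0; exists z; split=> // y ys yz.
  by apply: h; exists y.
have [|p [Kp clp]] := cK (filter_from D B) FF.
  by exists [::] => // z [].
have [||z [[_ h] pz]] := clp (B [:: p]) (ball p (r p)).
- by exists [:: p] => // y; rewrite inE => /eqP ->.
- by apply: nbhsx_ballx; exact: r0.
- by apply: h pz; rewrite inE.
Qed.

Lemma compact_subset_ball K x : compact K -> exists2 r, 0 < r & K `<=` ball x r.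
Proof.
move=> cK; have [|s [_ Ks]] := @compact_finite_cover K (fun=> 1) cK.
  by move=> *; exact: ltr01.
exists (\sum_(y <- s) (mdist x y + 1) + 1).
  by apply: ltr_wpDl => //; apply: sumr_ge0 => y _; rewrite addr_ge0// mdist_ge0.
move=> z /Ks[y ys]; apply: ball_subset.
rewrite (big_rem y)//= -addrA lerDl addr_ge0// ?sumr_ge0// => *.
by rewrite addr_ge0// mdist_ge0.
Qed.

Lemma compact_closed_metric K : compact K -> closed K.
Proof. by apply: compact_closed; exact: metric_hausdorff. Qed.

Lemma measurable_open U : open U -> measurable (U : set (borelType X)).
Proof. exact: sub_sigma_algebra. Qed.

Lemma measurable_closed A : closed A -> measurable (A : set (borelType X)).
Proof.
move=> cA; rewrite -[A]setCK; apply: measurableC; apply: measurable_open.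
exact: closed_openC.
Qed.

Lemma measurable_compact K : compact K -> measurable (K : set (borelType X)).
Proof. by move=> /compact_closed_metric/measurable_closed. Qed.

(* Vitali: select greedily the balls of largest radius. *)
Lemma vitali_finite (s : seq (X * R)) : (forall p, p \in s -> 0 < p.2) ->
  exists t : seq (X * R), [/\ uniq t, {subset t <= s},
    (forall p q, p \in t -> q \in t -> p != q ->
       ball p.1 p.2 `&` ball q.1 q.2 = set0) &
    forall p, p \in s -> exists2 q, q \in t &
       ball p.1 p.2 `<=` ball q.1 (4 * q.2)].
Proof.
elim: (size s) {-2}s (leqnn (size s)) => {s} [|n IH] s sn s0.
  by exists [::]; split=> // p; case: s sn {s0}.
have [->|sN0] := eqVneq s [::]; first by exists [::].
have [p ps pmax] : exists2 p, p \in s & forall q, q \in s -> q.2 <= p.2.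
  case: s sN0 {sn s0} => // p s _; elim: s p => [|q s IHs] p.
    by exists p => [|q]; rewrite inE// => /eqP ->.
  have [m ms mmax] := IHs p; have [qm|mq] := leP q.2 m.2.
    exists m; first by move: ms; rewrite !inE => /orP[->//|->]; rewrite !orbT.
    move=> u; rewrite !inE => /or3P[/eqP->|/eqP->//|us]; apply: mmax => //;
      by rewrite inE ?eqxx// us orbT.
  exists q; first by rewrite !inE eqxx orbT.
  have {}mmax u : u \in p :: s -> u.2 <= q.2.
    by move=> /mmax /le_trans; apply; exact: ltW.
  move=> u; rewrite !inE => /or3P[/eqP->|/eqP->//|us]; apply: mmax => //;
    by rewrite inE ?eqxx// us orbT.
pose far q := `[< ball p.1 p.2 `&` ball q.1 q.2 = set0 >].
pose s' := [seq q <- s | far q].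
have pp : 0 < p.2 := s0 _ ps.
have farNp : ~~ far p.
  apply/negP => /asboolP/seteqP[/(_ p.1) + _]; apply.
  by split; apply: ballxx.
have [||t [ut ts' td tc]] := IH s'.
- rewrite -ltnS; apply: leq_trans sn; rewrite size_filter ltn_neqAle count_size andbT.
  by apply/negP; rewrite -all_count => /allP/(_ _ ps); rewrite (negbTE farNp).
- by move=> q; rewrite mem_filter => /andP[_ /s0].
exists (p :: t); split=> /=.
- rewrite ut andbT; apply/negP => /ts'; rewrite mem_filter => /andP[+ _].
  by rewrite (negbTE farNp).
- move=> q; rewrite inE => /predU1P[->//|/ts'].
  by rewrite mem_filter => /andP[].
- move=> q u; rewrite !inE => /predU1P[->|qt] /predU1P[->|ut'] //; last exact: td.
  + by rewrite eqxx.
  + by move=> _; move/ts': ut'; rewrite mem_filter => /andP[/asboolP].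
  + by move=> _; move/ts': qt; rewrite mem_filter setIC => /andP[/asboolP].
- move=> q qs; have [fq|] := boolP (far q).
    have [|u ut' qu] := tc q; first by rewrite mem_filter fq.
    by exists u => //; rewrite inE ut' orbT.
  move=> /asboolPn/eqP/set0P[z [/in_ball pz /in_ball qz]].
  (* Intersecting balls with [q.2 <= p.2] already give the factor 3; 4 is a power of two, so that
     doubling applies directly. *)
  exists p; first by rewrite inE eqxx.
  apply: ball_subset; have := metric_triangle p.1 z q.1.
  by rewrite (metric_sym z); have := pmax _ qs; lra.
Qed.

End metric_space.

(** * Regularity of finite Borel measures *)

Section borel_regularity.
Context {R : realType} {X : completeMetricType R}.
Implicit Types (A F U E : set X).
Local Open Scope ereal_scope.

Definition thickening A (n : nat) : set X := \bigcup_(y in A) ball y n.+1%:R^-1.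

Lemma thickening_open A n : open (thickening A n).
Proof. by apply: bigcup_open => y _; exact: metric_ball_open. Qed.

Lemma subset_thickening A n : A `<=` thickening A n.
Proof. by move=> y Ay; exists y => //; apply: ballxx. Qed.

Lemma bigcap_thickening A : closed A -> \bigcap_n thickening A n = A.
Proof.
move=> cA; apply/seteqP; split=> [y yA|y Ay n _]; last exact: subset_thickening.
apply: cA => B /nbhs_ballP[e /= e0 yB].
have [n _ /(_ n (leqnn n)) ne] := near_infty_natSinv_lt (PosNum e0).
have [z Az zy] := yA n I.
exists z; split=> //; apply: yB; apply: le_ball (ball_sym zy).
exact: ltW.
Qed.

Lemma le_thickening A n m : (n <= m)%N -> thickening A m `<=` thickening A n.
Proof.
move=> nm y [z Az zy]; exists z => //; apply: le_ball zy.
by rewrite lef_pV2 ?posrE// ler_nat.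
Qed.

Section finite_measure.
Variable nu : {measure set (borelType X) -> \bar R}.
Hypothesis nu_fin : nu setT < +oo.

Let nu_lty (A : set (borelType X)) : measurable A -> nu A < +oo.
Proof. by move=> mA; apply: le_lt_trans nu_fin; apply: le_measure; rewrite ?inE. Qed.

(** Continuity from above, valid because [nu] is finite. *)
Let small (V : (set (borelType X))^nat) (e : R) : (0 < e)%R ->
  (forall n, measurable (V n)) -> nonincreasing_seq V ->
  nu (\bigcap_n V n) < e%:E -> exists n, nu (V n) < e%:E.
Proof.
move=> e0 mV ndV Ve.
have cV : nu (V n) @[n --> \oo] --> nu (\bigcap_n V n).
  by apply: nonincreasing_cvg_mu => //; [exact: nu_lty|exact: bigcapT_measurable].
have [n _ /(_ n (leqnn n))] := cV _ (open_ereal_lt' Ve).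
by exists n.
Qed.

(** The approximable sets form a sigma-algebra. It contains the closed sets, which are intersections
    of their thickenings, hence all Borel sets. *)
Lemma finite_borel_regular A (e : R) : measurable (A : set (borelType X)) ->
  (0 < e)%R -> exists F U, [/\ closed F, open U, F `<=` A, A `<=` U &
    nu (U `\` F) < e%:E].
Proof.
pose good := [set A : set (borelType X) | measurable A /\ forall e : R, (0 < e)%R ->
  exists F U, [/\ closed F, open U, F `<=` A, A `<=` U & nu (U `\` F) < e%:E]].
suff : measurable `<=` good by move=> h /h[_]; exact.
have goodC B : good B -> good (~` B).
  move=> [mB gB]; split; first exact: measurableC.
  move=> d /gB[F [U [cF oU FB BU UF]]]; exists (~` U), (~` F); split.
  - exact: open_closedC.
  - exact: closed_openC.
  - exact: subsetC.
  - exact: subsetC.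
  - by rewrite setDE setCK setIC -setDE.
have good_closed B : closed B -> good B.
  move=> cB; have mB := measurable_closed cB; split=> // d d0.
  have [|||n nB] := @small (fun n => thickening B n `\` B) d d0.
  - move=> n; apply: measurableD => //; apply: measurable_open.
    exact: thickening_open.
  - move=> n m nm; apply/subsetPset; apply: setSD; exact: le_thickening.
  - rewrite (_ : \bigcap_n _ = set0) ?measure0 ?lte_fin//.
    rewrite -subset0 => x xB; have := bigcap_thickening cB.
    move=> /seteqP[/(_ x) + _] => Bx; have [] := xB 0%N I; move=> _; apply.
    by apply: Bx => n _; have [] := xB n I.
  - by exists B, (thickening B n); split=> //; [exact: thickening_open|
      exact: subset_thickening].
apply: smallest_sub => /=; last first.
  by move=> U oU; rewrite -[U]setCK; apply/goodC/good_closed/open_closedC.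
split.
- exact/good_closed/closed0.
- by move=> B /goodC; rewrite setTD.
- move=> B gB; have mB n : measurable (B n : set (borelType X)) := (gB n).1.
  split; first exact: bigcupT_measurable.
  move=> d d0.
  (* The errors add up to at most [d / 2], strictly below [d]. *)
  have /choice[F /choice[U FU]] : forall n, exists F U, [/\ closed F, open U,
      F `<=` B n, B n `<=` U & nu (U `\` F) < (d / 2 / (2 ^ n.+1)%:R)%:E].
    move=> n; apply: (gB n).2; rewrite !divr_gt0// ltr0n expn_gt0//.
  have mF n : measurable (F n : set (borelType X)).
    by have [/measurable_closed] := FU n.
  have mU n : measurable (U n : set (borelType X)).
    by have [_ /measurable_open] := FU n.
  (* An infinite union of closed sets need not be closed, so only finitely many [F i] are kept;
     continuity from above shows that enough of them suffice. *)
  pose FF n : set X := \big[setU/set0]_(i < n) F i.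
  have mFF n : measurable (FF n : set (borelType X)).
    by apply: bigsetU_measurable => i _.
  have [|||n nB] := @small (fun n => \bigcup_n U n `\` FF n) d d0.
  + by move=> n; apply: measurableD => //; exact: bigcupT_measurable.
  + by move=> n m nm; apply/subsetPset; apply: setDS; apply: subset_bigsetU.
  + apply: (@le_lt_trans _ _ (nu (\bigcup_n (U n `\` F n)))).
      apply: le_measure; rewrite ?inE.
      * apply: bigcapT_measurable => n.
        by apply: measurableD => //; exact: bigcupT_measurable.
      * by apply: bigcupT_measurable => n; exact: measurableD.
      * move=> x xn; have [[n _ Un] _] := xn 0%N I; exists n => //; split=> // Fx.
        have [_] := xn n.+1 I; apply; rewrite /FF big_ord_recr/=; by right.
    apply: (@le_lt_trans _ _ (\sum_(n <oo) nu (U n `\` F n))).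
      apply: measure_sigma_subadditive => //.
      * by move=> n; exact: measurableD.
      * by apply: bigcupT_measurable => n; exact: measurableD.
    apply: (@le_lt_trans _ _ (d / 2)%:E); last first.
      by rewrite lte_fin ltr_pdivrMr// ltr_pMr// ltr1n.
    apply: le_trans (epsilon_trick0 xpredT _); last by rewrite divr_ge0// ltW.
    by apply: lee_nneseries => // n _; apply: ltW; have [] := FU n.
  + exists (FF n), (\bigcup_n U n); split=> //.
    * apply: closed_bigsetU => i _; by have [] := FU i.
    * by apply: bigcup_open => i _; have [] := FU i.
    * rewrite /FF -bigcup_mkord => x [i /= _ Fx]; exists i => //.
      by have [_ _ + _ _] := FU i; apply.
    * by apply: subset_bigcup => i _; have [] := FU i.
Qed.

End finite_measure.
End borel_regularity.

(** * Doubling measures *)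

Lemma exists_pow2_ge {R : realType} (a b : R) : 0 < b ->
  exists k, a <= 2 ^+ k * b.
Proof.
move=> b0; exists (Num.truncn `|a / b|).+1.
rewrite -ler_pdivrMr// (le_trans (ler_norm _))//.
apply: ltW; apply: lt_le_trans (truncnS_gt _) _.
by rewrite -natrX ler_nat ltnW// ltn_expl.
Qed.

Section finite_families.
Context d {T : measurableType d} {R : realType}.
Variable mu : {measure set T -> \bar R}.
Local Open Scope ereal_scope.

Lemma sum_measure_disjoint (I : eqType) (s : seq I) (F : I -> set T) (B : set T) :
  uniq s -> measurable B -> (forall i, i \in s -> measurable (F i)) ->
  (forall i, i \in s -> F i `<=` B) ->
  (forall i j, i \in s -> j \in s -> i != j -> F i `&` F j = set0) ->
  \sum_(i <- s) mu (F i) <= mu B.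
Proof.
elim: s B => [|i s IH] B; first by rewrite big_nil.
move=> /= /andP[iNs us] mB mF FB dF; rewrite big_cons.
have mFi : measurable (F i) by apply: mF; rewrite inE eqxx.
rewrite [leRHS](measureDI mu mB mFi) addeC; apply: leeD.
  apply: IH => //.
  - exact: measurableD.
  - by move=> j js; apply: mF; rewrite inE js orbT.
  - move=> j js x Fjx; split; first by apply: FB Fjx; rewrite inE js orbT.
    move=> Fix; have : (F i `&` F j) x by [].
    rewrite dF ?inE ?eqxx ?js ?orbT//.
    by apply: contraNneq iNs => ->.
  - by move=> j k js ks; apply: dF; rewrite inE ?js ?ks orbT.
by apply: le_measure; rewrite ?inE//; [exact: measurableI|
  move=> x Fx; split=> //; apply: (FB i) => //; rewrite inE eqxx].
Qed.

Lemma measure_le_sum_cover (I : eqType) (s : seq I) (F : I -> set T) (B : set T) :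
  measurable B -> (forall i, i \in s -> measurable (F i)) ->
  (forall x, B x -> exists2 i, i \in s & F i x) ->
  mu B <= \sum_(i <- s) mu (F i).
Proof.
elim: s B => [|i s IH] B mB mF cB.
  by rewrite big_nil (_ : B = set0) ?measure0// -subset0 => x /cB[].
have mFi : measurable (F i) by apply: mF; rewrite inE eqxx.
rewrite big_cons (measureDI mu mB mFi) addeC; apply: leeD.
  by apply: le_measure; rewrite ?inE//; exact: measurableI.
apply: IH; first exact: measurableD.
  by move=> j js; apply: mF; rewrite inE js orbT.
move=> x [/cB[j + Fjx] Fix].
by rewrite inE => /predU1P[ji|js]; [rewrite ji in Fjx|exists j].
Qed.

End finite_families.

Section doubling_measure.
Context {R : realType} {X : completeMetricType R}.
Variable mu : {measure set (borelType X) -> \bar R}.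
Implicit Types (x y z : X) (r : R).
Variable Cd : R.
Hypothesis Cd1 : 1 < Cd.
Hypothesis dbl : forall x r, 0 < r ->
  [/\ (0 < mu (ball x (2 * r)%R))%E,
      (mu (ball x (2 * r)%R) <= Cd%:E * mu (ball x r))%E &
      (Cd%:E * mu (ball x r) < +oo)%E].

Let Cd0 : 0 < Cd. Proof. exact: lt_trans Cd1. Qed.

Lemma mu_ball_gt0 x r : 0 < r -> (0 < mu (ball x r))%E.
Proof.
move=> r0; have [] := @dbl x (r / 2); first by rewrite divr_gt0.
by rewrite mulrC divfK.
Qed.

Lemma mu_ball_lty x r : (mu (ball x r) < +oo)%E.
Proof.
have [r0|r0] := ltP 0 r; last first.
  rewrite (_ : ball x r = set0) ?measure0// -subset0 => y /in_ball.
  by move=> /lt_le_trans/(_ r0); rewrite ltNge mdist_ge0.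
have [_ _] := dbl x r0.
by case: (mu _) => [s||]//; rewrite ?ltry// gt0_muley ?lte_fin.
Qed.

(** [fine] sends [+oo] to 0, so [vol] agrees with [mu] only on sets of finite measure; this is why
    later lemmas place their sets inside a ball. *)
Definition vol (A : set X) : R := fine (mu A).

Lemma volE x r A : measurable (A : set (borelType X)) -> A `<=` ball x r ->
  mu A = (vol A)%:E.
Proof.
move=> mA Ax; rewrite fineK// ge0_fin_numE//.
by apply: le_lt_trans (mu_ball_lty x r); apply: le_measure; rewrite ?inE//;
  exact: measurable_mball.
Qed.

Lemma vol_ge0 A : 0 <= vol A. Proof. exact: fine_ge0. Qed.

Lemma vol_ballE x r : mu (ball x r) = (vol (ball x r))%:E.
Proof. by apply: (@volE x r) => //; exact: measurable_mball. Qed.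

Lemma vol_ball_gt0 x r : 0 < r -> 0 < vol (ball x r).
Proof. by move=> r0; rewrite -lte_fin -vol_ballE mu_ball_gt0. Qed.

Lemma le_vol x r A B : measurable (A : set (borelType X)) ->
  measurable (B : set (borelType X)) -> A `<=` B -> B `<=` ball x r ->
  vol A <= vol B.
Proof.
move=> mA mB AB Bx; rewrite -lee_fin -(volE mB Bx) -(volE mA (subset_trans AB Bx)).
by apply: le_measure; rewrite ?inE.
Qed.

Lemma vol_double x r : 0 < r -> vol (ball x (2 * r)) <= Cd * vol (ball x r).
Proof.
by move=> r0; have [_ + _] := dbl x r0; rewrite !vol_ballE -EFinM lee_fin.
Qed.

Lemma vol_double_iter n x r : 0 < r ->
  vol (ball x (2 ^+ n * r)) <= Cd ^+ n * vol (ball x r).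
Proof.
move=> r0; elim: n => [|n IH]; first by rewrite !expr0 !mul1r.
rewrite !exprS -!mulrA; apply: le_trans (vol_double _ _) _.
  by rewrite mulr_gt0// exprn_gt0.
by rewrite ler_pM2l.
Qed.

Lemma le_vol_ball x y r s : mdist x y + s <= r -> vol (ball y s) <= vol (ball x r).
Proof.
move=> h; apply: (@le_vol x r) => //; [exact: measurable_mball..|].
exact: ball_subset.
Qed.

Definition separated (e : R) (s : seq X) :=
  forall p q, p \in s -> q \in s -> p != q -> e <= mdist p q.

(** Balls of radius [e / 2] about separated points are disjoint, and by doubling each has at least a
    fixed share of the measure of a ball containing them all. *)
Lemma packing x r e : 0 < r -> 0 < e -> exists N : nat, forall s : seq X,
  uniq s -> separated e s -> (forall p, p \in s -> ball x r p) -> (size s <= N)%N.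
Proof.
move=> r0 e0; have e20 : 0 < e / 2 by rewrite divr_gt0.
(* For [p] in [ball x r], the ball of radius [2 * r + e] about [p] contains [ball x (r + e)]; [k]
   doublings of [e / 2] reach that radius. *)
have [k hk] := exists_pow2_ge (2 * r + e) e20.
exists (Num.truncn (Cd ^+ k)) => s us ss sx.
rewrite -ltnS -(ltr_nat R); apply: le_lt_trans (truncnS_gt _).
have M0 : 0 < vol (ball x (r + e)) by apply: vol_ball_gt0; rewrite addr_gt0.
rewrite -(ler_pM2r M0).
have pk p : p \in s -> vol (ball x (r + e)) <= Cd ^+ k * vol (ball p (e / 2)).
  move=> /sx/in_ball xp; apply: le_trans (vol_double_iter _ _ e20).
  by apply: le_vol_ball; rewrite metric_sym; lra.
have : \sum_(p <- s) vol (ball p (e / 2)) <= vol (ball x (r + e)).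
  rewrite -lee_fin -sumEFin -vol_ballE.
  under eq_bigr do rewrite -vol_ballE.
  apply: sum_measure_disjoint => //; [exact: measurable_mball|..].
  - by move=> p _; exact: measurable_mball.
  - by move=> p /sx/in_ball xp; apply: ball_subset; lra.
  - move=> p q ps qs pq; rewrite -subset0 => z [/in_ball pz /in_ball qz].
    have := ss _ _ ps qs pq; have := metric_triangle p z q.
    by rewrite (metric_sym z q); lra.
move=> hs; apply: le_trans (ler_wpM2l _ hs); last first.
  by rewrite exprn_ge0// ltW.
rewrite mulr_sumr; set M := vol _.
have -> : (size s)%:R * M = \sum_(p <- s) M.
  by rewrite big_const_seq count_predT iter_addr addr0 mulr_natl.
rewrite big_seq [leRHS]big_seq.
by apply: ler_sum => p /pk.
Qed.

Lemma closed_ball_sub x r : 0 < r -> closed_ball x r `<=` ball x (2 * r).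
Proof.
move=> r0 y /(_ _ (nbhsx_ballx y r r0))[z [/in_ball xz /in_ball yz]].
apply/in_ball; have := metric_triangle x z y; rewrite (metric_sym z); lra.
Qed.

(** A separated set of maximal size, which exists by [packing], is an [e]-net: a point far from all
    its members could be added. *)
Lemma compact_closed_ball x r : 0 < r -> compact (closed_ball x r).
Proof.
move=> r0; apply: totally_bounded_compact; first exact: closed_closure.
move=> e e0; have r20 : 0 < 2 * r by rewrite mulr_gt0.
have [N hN] := packing x r20 e0.
pose P n := `[< exists s : seq X, [/\ uniq s, separated e s,
  (forall p, p \in s -> ball x (2 * r) p) & size s = n] >].
have P0 : exists n, P n by exists 0%N; apply/asboolP; exists [::].
have PN n : P n -> (n <= N)%N by move=> /asboolP[s [us ss sx <-]]; exact: hN.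
case: (ex_maxnP P0 PN) => n /asboolP[s [us ss sx sn]] maxn.
exists s => y /(closed_ball_sub r0) xy; apply: contrapT => noy.
have far p : p \in s -> e <= mdist p y.
  move=> ps; rewrite leNgt; apply/negP => py; apply: noy; exists p => //.
  exact/in_ball.
suff /maxn : P n.+1 by rewrite ltnn.
apply/asboolP; exists (y :: s); split => /=; last by rewrite sn.
- rewrite us andbT; apply/negP => /far; rewrite mdistxx.
  by rewrite leNgt e0.
- move=> p q; rewrite !inE => /predU1P[->|ps] /predU1P[->|qs].
  + by rewrite eqxx.
  + by rewrite metric_sym => _; exact: far.
  + by move=> _; exact: far.
  + exact: ss.
- by move=> p; rewrite inE => /predU1P[->|/sx].
Qed.

(** Regularity is applied to [mu] restricted to the ball, which is finite. The inner closed set is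
    compact because closed balls are; the outer open set is cut down to the ball. *)
Lemma compact_open_approx x r (E : set X) e :
  measurable (E : set (borelType X)) -> E `<=` ball x r -> 0 < r -> 0 < e ->
  exists K U, [/\ compact K /\ open U, K `<=` E, E `<=` U, U `<=` ball x r &
    vol (U `\` K) < e].
Proof.
move=> mE Ex r0 e0; pose nu := mrestr mu (measurable_mball x r).
have nufin : (nu setT < +oo)%E by rewrite /nu /mrestr/= setTI mu_ball_lty.
have [F [U [cF oU FE EU UF]]] := finite_borel_regular nufin mE e0.
exists F, (U `&` ball x r); split=> //; first split.
- rewrite (_ : F = F `&` closed_ball x r).
    by rewrite setIC; exact: compact_closedI (compact_closed_ball r0) cF.
  rewrite setIidl//; apply: subset_trans FE (subset_trans Ex _).
  exact: subset_closure.
- by apply: openI => //; exact: metric_ball_open.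
- by move=> y Ey; split; [exact: EU|exact: Ex].
- rewrite -lte_fin -(@volE x r).
  + by move: UF; rewrite /nu/= /mrestr/= setIDAC setIDA.
  + apply: (@measurableD _ (borelType X)); last exact: measurable_closed.
    by apply: measurable_open; apply: openI => //; exact: metric_ball_open.
  + by move=> y [[_]].
Qed.

Lemma vol_split x r (A B : set (borelType X)) : measurable A -> measurable B ->
  A `<=` ball x r -> vol A = vol (A `\` B) + vol (A `&` B).
Proof.
move=> mA mB Ax; apply: EFin_inj; rewrite EFinD.
have mAB : measurable (A `\` B) by exact: measurableD.
have mAB' : measurable (A `&` B) by exact: measurableI.
rewrite -(volE mA Ax) -(@volE x r _ mAB) -?(@volE x r _ mAB').
- exact: measureDI.
- by move=> y [/Ax].
- by move=> y [/Ax].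
Qed.

Lemma vol_sum_disjoint x r (I : eqType) (s : seq I) (F : I -> set (borelType X))
    (B : set (borelType X)) :
  uniq s -> measurable B -> (forall i, measurable (F i)) ->
  (forall i, i \in s -> F i `<=` B) -> B `<=` ball x r ->
  (forall i j, i \in s -> j \in s -> i != j -> F i `&` F j = set0) ->
  \sum_(i <- s) vol (F i) <= vol B.
Proof.
move=> us mB mF FB Bx dF; rewrite -lee_fin -sumEFin big_seq.
under eq_bigr => i si do rewrite -(volE (mF i) (subset_trans (FB i si) Bx)).
by rewrite -big_seq -(volE mB Bx); apply: sum_measure_disjoint.
Qed.

Lemma vol_le_sum_cover x r (I : eqType) (s : seq I) (c : I -> X) (q : I -> R)
    (B : set (borelType X)) : measurable B -> B `<=` ball x r ->
  (forall y, B y -> exists2 i, i \in s & ball (c i) (q i) y) ->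
  vol B <= \sum_(i <- s) vol (ball (c i) (q i)).
Proof.
move=> mB Bx cB; rewrite -lee_fin -sumEFin.
under eq_bigr => i _ do rewrite -vol_ballE.
rewrite -(volE mB Bx); apply: measure_le_sum_cover => // i _.
exact: measurable_mball.
Qed.

End doubling_measure.

(** * The measure with density [w] *)

Section weight_mass.
Context {R : realType} {X : completeMetricType R}.
Variable mu : {measure set (borelType X) -> \bar R}.
Implicit Types (x y z : X) (r : R) (A B : set (borelType X)).
Variable Cd : R.
Hypothesis Cd1 : 1 < Cd.
Hypothesis dbl : forall x r, 0 < r ->
  [/\ (0 < mu (ball x (2 * r)%R))%E,
      (mu (ball x (2 * r)%R) <= Cd%:E * mu (ball x r))%E &
      (Cd%:E * mu (ball x r) < +oo)%E].
Local Notation vol := (vol mu).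

Variable w : borelType X -> R.
Hypothesis w0 : forall x, 0 <= w x.
Hypothesis mw : measurable_fun setT w.
Hypothesis iw : forall x r, mu.-integrable (ball x r) (EFin \o w).
Hypothesis wpos : {ae mu, forall x, 0 < w x}.

Definition mass A : R := fine (\int[mu]_(y in A) (w y)%:E).

Let mEw A : measurable_fun A (fun y => (w y)%:E).
Proof. by apply/measurable_EFinP; apply: measurable_funTS. Qed.

Lemma mass_ge0 A : 0 <= mass A.
Proof. by apply: fine_ge0; apply: integral_ge0 => y _; rewrite lee_fin. Qed.

Lemma massE x r A : measurable A -> A `<=` ball x r ->
  (\int[mu]_(y in A) (w y)%:E = (mass A)%:E)%E.
Proof.
move=> mA Ax; rewrite fineK//; apply: integrable_fin_num => //.
exact: (@integrableS _ _ _ mu (ball x r) A _ (measurable_mball x r)).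
Qed.

Lemma le_mass x r A B : measurable A -> measurable B -> A `<=` B ->
  B `<=` ball x r -> mass A <= mass B.
Proof.
move=> mA mB AB Bx; rewrite -lee_fin -(massE mB Bx) -(massE mA (subset_trans AB Bx)).
by apply: ge0_subset_integral => // y _; rewrite lee_fin.
Qed.

Lemma mass_split x r A B : measurable A -> measurable B -> A `<=` ball x r ->
  mass A = mass (A `\` B) + mass (A `&` B).
Proof.
move=> mA mB Ax; apply: EFin_inj; rewrite EFinD.
have mAB : measurable (A `\` B) by exact: measurableD.
have mAB' : measurable (A `&` B) by exact: measurableI.
rewrite -!(@massE x r)//; last 2 first.
- by move=> y [/Ax].
- by move=> y [/Ax].
have {1}-> : A = (A `\` B) `|` (A `&` B).
  by rewrite setDE -setIUr setUC setUCr setIT.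
rewrite ge0_integral_setU//.
- by move=> y _; rewrite lee_fin.
- by apply/disj_setPS => y [[_ ?] [_ ?]].
Qed.

Lemma mass_le_ae x r A M : measurable A -> A `<=` ball x r -> 0 <= M ->
  {ae mu, forall y, A y -> w y <= M} -> mass A <= M * vol A.
Proof.
move=> mA Ax M0 wM; rewrite -lee_fin EFinM -(massE mA Ax) -(volE Cd1 dbl mA Ax).
rewrite -integral_cst//; apply: ae_ge0_le_integral => //.
- by move=> y _; rewrite lee_fin.
Qed.

(** A vanishing integral would force [w = 0] almost everywhere on a ball of positive measure,
    against [wpos]. *)
Lemma mass_ball_gt0 x r : 0 < r -> 0 < mass (ball x r).
Proof.
move=> r0; rewrite lt_neqAle mass_ge0 andbT; apply/negP => /eqP m0.
have mB := measurable_mball x r.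
have : (\int[mu]_(y in ball x r) `|(w y)%:E| = 0)%E.
  under eq_integral do rewrite gee0_abs ?lee_fin//.
  by rewrite (massE mB (@subset_refl _ _)) -m0.
move=> /(ae_eq_integral_abs mu mB (@mEw _)) ae0.
have : mu.-negligible (ball x r).
  have [N [mN N0 sN]] := filterI ae0 wpos; exists N; split=> // y xy.
  by apply: sN => /= -[/(_ xy) [->]]; rewrite ltxx.
move=> /(measure_negligible mB) B0; have := mu_ball_gt0 dbl x r0.
by rewrite B0 ltxx.
Qed.

Lemma mass_sum_disjoint x r (I : eqType) (s : seq I) (F : I -> set X) B :
  uniq s -> measurable B -> (forall i, measurable (F i : set (borelType X))) ->
  (forall i, i \in s -> F i `<=` B) -> B `<=` ball x r ->
  (forall i j, i \in s -> j \in s -> i != j -> F i `&` F j = set0) ->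
  \sum_(i <- s) mass (F i) <= mass B.
Proof.
move=> us mB mF FB Bx dF; rewrite -lee_fin -sumEFin big_seq.
under eq_bigr => i si do
  rewrite -(massE (mF i) (subset_trans (FB i si) Bx)).
rewrite -big_seq -(@ge0_integral_bigsetU _ _ _ mu _ F)//.
- rewrite -(massE mB Bx); apply: ge0_subset_integral => //.
  + by apply: bigsetU_measurable => i _.
  + by move=> y _; rewrite lee_fin.
  + rewrite big_seq; apply: (big_ind (fun A => A `<=` B)) => // C D CB DB.
    by rewrite subUset.
- move=> i j /= si sj [y Fy]; apply: contrapT => /eqP ij.
  by move: Fy; rewrite dF.
- by move=> y _; rewrite lee_fin.
Qed.

End weight_mass.

(** * Decay of sublevel sets under a reverse Hoelder inequality *)

Lemma exists_exprn_le_half {R : realType} (q : R) : 0 <= q < 1 -> exists n, q ^+ n <= 2^-1.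
Proof.
move=> /andP[q0 q1].
have /cvgr_lt/(_ 2^-1) : (q ^+ n @[n --> \oo] --> (0 : R))%classic.
  by apply: cvg_expr; rewrite ger0_norm.
case; first by rewrite invr_gt0.
by move=> n _ /(_ n (leqnn n))/ltW ?; exists n.
Qed.

Section reverse_holder.
Context {R : realType} {X : completeMetricType R}.
Variable mu : {measure set (borelType X) -> \bar R}.
Implicit Types (x y z : X) (r : R) (A B : set (borelType X)).
Variable Cd : R.
Hypothesis Cd1 : 1 < Cd.
Hypothesis dbl : forall x r, 0 < r ->
  [/\ (0 < mu (ball x (2 * r)%R))%E,
      (mu (ball x (2 * r)%R) <= Cd%:E * mu (ball x r))%E &
      (Cd%:E * mu (ball x r) < +oo)%E].
Local Notation vol := (vol mu).

Variable w : borelType X -> R.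
Hypothesis w0 : forall x, 0 <= w x.
Hypothesis mw : measurable_fun setT w.
Hypothesis iw : forall x r, mu.-integrable (ball x r) (EFin \o w).
Hypothesis wpos : {ae mu, forall x, 0 < w x}.
Local Notation mass := (mass mu w).

Variable CR : R.
Hypothesis CR1 : 1 <= CR.
Hypothesis RH : forall x r, 0 < r ->
  {ae mu, forall y : borelType X, ball x r y -> w y <= CR * (mass (ball x r) / vol (ball x r))}.

Let CR0 : 0 < CR. Proof. exact: lt_le_trans CR1. Qed.

Lemma mass_le_vol x r A : 0 < r -> measurable A -> A `<=` ball x r ->
  mass A <= CR * (mass (ball x r) / vol (ball x r)) * vol A.
Proof.
move=> r0 mA Ax; apply: (mass_le_ae Cd1 dbl w0 mw iw mA Ax).
  by rewrite !mulr_ge0 ?invr_ge0 ?mass_ge0 ?vol_ge0// ltW.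
by have := RH x r0; apply: filterS => y + Ay; apply; exact: Ax.
Qed.

(** * Doubling of the weighted measure *)

Section mass_doubling.
Variables alpha Ca : R.
Hypothesis alpha01 : 0 < alpha <= 1.
Hypothesis Ca1 : 1 <= Ca.
Hypothesis annular : forall x r (delta : R), 0 < r -> 0 < delta < 1 ->
  (mu (ball x r `\` ball x ((1 - delta) * r)%R)
     <= (Ca * delta `^ alpha)%:E * mu (ball x r))%E.

(** By [mass_le_vol] and annular decay, a thin enough outer annulus carries at most half of the mass
    of a ball. Removing such annuli until the radius has halved costs a fixed power of 2. *)
Lemma mass_double : exists2 D : R, 1 <= D & forall x r, 0 < r ->
  mass (ball x (2 * r)) <= D * mass (ball x r).
Proof.
have [alpha0 _] := andP alpha01.
have Ca0 : 0 < Ca by exact: lt_le_trans Ca1.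
(* As [delta] to the power [alpha] is [t], the annulus has mass at most [CR * Ca * t = 1 / 2] times
   that of the ball. *)
pose t : R := (2 * (CR * Ca))^-1; pose delta := t `^ alpha^-1.
have t0 : 0 < t by rewrite invr_gt0 !mulr_gt0.
have t1 : t < 1.
  rewrite invf_lt1 ?mulr_gt0//.
  have : 1 <= CR * Ca by rewrite mulr_ege1.
  lra.
have d0 : 0 < delta by rewrite powR_gt0.
have dt : delta `^ alpha = t.
  by rewrite /delta -powRrM mulVf ?powRr1 ?ltW// gt_eqF.
have d1 : delta < 1.
  rewrite ltNge; apply/negP => d1.
  have : 1 <= delta `^ alpha.
    have := @ge0_ler_powR _ alpha (ltW alpha0) 1 delta.
    by rewrite powR1 !nnegrE ler01 (ltW d0); apply.
  by rewrite dt leNgt t1.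
have shrink x r : 0 < r -> mass (ball x r) <= 2 * mass (ball x ((1 - delta) * r)).
  move=> r0; set B := ball x r; set B' := ball x ((1 - delta) * r).
  have mB : measurable (B : set (borelType X)) := measurable_mball _ _.
  have mB' : measurable (B' : set (borelType X)) := measurable_mball _ _.
  have B'B : B' `<=` B by apply: le_ball; rewrite ler_piMl ?ltW//; lra.
  have v0 : 0 < vol B := vol_ball_gt0 Cd1 dbl x r0.
  have := mass_split w0 mw iw mB mB' (@subset_refl _ _).
  rewrite setIidr//.
  have mBB' : measurable (B `\` B' : set (borelType X)) by exact: measurableD.
  have BB' : B `\` B' `<=` B by move=> y [].
  have := mass_le_vol r0 mBB' BB'.
  have : vol (B `\` B') <= Ca * t * vol B.
    rewrite -lee_fin -(volE Cd1 dbl mBB' BB') EFinM -(vol_ballE Cd1 dbl) -dt.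
    by apply: annular => //; rewrite d0.
  move=> /(ler_wpM2l (_ : 0 <= CR * (mass B / vol B))) h1.
  have /h1{h1} : 0 <= CR * (mass B / vol B).
    by rewrite !mulr_ge0 ?invr_ge0 ?mass_ge0 ?vol_ge0// ltW.
  rewrite (_ : CR * (mass B / vol B) * (Ca * t * vol B) = mass B / 2).
    by lra.
  rewrite /t !invfM.
  rewrite (_ : CR * (mass B / vol B) * (Ca * (2^-1 * (CR^-1 / Ca)) * vol B) =
    (CR / CR) * (Ca / Ca) * (vol B / vol B) * (mass B / 2)); last by lra.
  by rewrite !divff ?mul1r// gt_eqF.
have shrinkn n x r : 0 < r ->
    mass (ball x r) <= 2 ^+ n * mass (ball x ((1 - delta) ^+ n * r)).
  move=> r0; elim: n => [|n IH]; first by rewrite !expr0 !mul1r.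
  apply: le_trans IH _; rewrite exprSr -mulrA ler_pM2l ?exprn_gt0//.
  by rewrite exprS -mulrA; apply: shrink; rewrite mulr_gt0// exprn_gt0// subr_gt0.
have [n hn] : exists n, (1 - delta) ^+ n <= 2^-1 by apply: exists_exprn_le_half; lra.
exists (2 ^+ n); first by rewrite exprn_ege1// ler1n.
move=> x r r0; have r20 : 0 < 2 * r by rewrite mulr_gt0.
apply: le_trans (shrinkn n x _ r20) _; rewrite ler_pM2l ?exprn_gt0//.
apply: (le_mass w0 mw iw (measurable_mball _ _) (measurable_mball _ _) _ (@subset_refl _ _)).
apply: le_ball; apply: le_trans (ler_wpM2r (ltW r20) hn) _.
by rewrite mulKf.
Qed.

End mass_doubling.

(** * Stopping balls and decay of sublevel sets *)

Section level_sets.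
Variable D : R.
Hypothesis D1 : 1 <= D.
Hypothesis massD : forall x r, 0 < r ->
  mass (ball x (2 * r)) <= D * mass (ball x r).

(* [2 * D <= kap] makes [w] large on part of each stopping ball; [4 * Cd ^+ 2 <= kap]
   makes the balls that never stop cover at most half of the set. *)
Let kap : R := 4 * D * Cd ^+ 2.
(** On a ball of mean at most [kap * l], reverse Hoelder gives [w <= CR * kap * l] almost
    everywhere; the factor 2 makes this strict, as [sublevel] requires. *)
Let Lam : R := 2 * CR * kap.

Let D0 : 0 < D. Proof. exact: lt_le_trans D1. Qed.
Let Cd0 : 0 < Cd. Proof. exact: lt_trans Cd1. Qed.
Let kap0 : 0 < kap. Proof. by rewrite !mulr_gt0// exprn_gt0. Qed.

Definition sublevel (l : R) : set (borelType X) := [set y | w y < l].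

Lemma measurable_sublevel l : measurable (sublevel l).
Proof.
rewrite (_ : sublevel l = setT `&` w @^-1` `]-oo, l[%classic).
  exact: mw.
by rewrite setTI; apply/seteqP; split=> y /=; rewrite in_itv.
Qed.

Local Notation bball x r := (ball x r : set (borelType X)).

Let mB x r : measurable (bball x r) := measurable_mball x r.

(** The part where [w < l] carries at most half of the mass, so the rest carries at least half;
    reverse Hoelder then gives that rest a share of at least [1 / (2 * CR)] of the volume. *)
Lemma vol_le_high x r l : 0 < r -> 0 < l ->
  2 * l * vol (ball x r) <= mass (ball x r) ->
  vol (ball x r) <= 2 * CR * vol (bball x r `\` sublevel l).
Proof.
move=> r0 l0 hl; have ms := measurable_sublevel l.
have mlo : measurable (bball x r `&` sublevel l) by exact: measurableI.
have mhi : measurable (bball x r `\` sublevel l) by exact: measurableD.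
have slo : bball x r `&` sublevel l `<=` ball x r by move=> y [].
have shi : bball x r `\` sublevel l `<=` ball x r by move=> y [].
have v0 := vol_ball_gt0 Cd1 dbl x r0.
have m0 := mass_ball_gt0 dbl w0 mw iw wpos x r0.
have lo : mass (bball x r `&` sublevel l) <= l * vol (ball x r).
  apply: (@le_trans _ _ (l * vol (bball x r `&` sublevel l))).
    apply: (mass_le_ae Cd1 dbl w0 mw iw mlo slo (ltW l0)).
    by apply: aeW => y [_ /ltW].
  by rewrite ler_pM2l//; exact: (le_vol Cd1 dbl mlo (mB x r) slo (@subset_refl _ _)).
have := mass_split w0 mw iw (mB x r) ms (@subset_refl _ _).
have hi := mass_le_vol r0 mhi shi.
move=> split.
have h : mass (ball x r) / 2 <=
    CR * (mass (ball x r) / vol (ball x r)) * vol (bball x r `\` sublevel l) by lra.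
rewrite -(ler_pM2l (_ : 0 < mass (ball x r) / vol (ball x r) / 2)); last first.
  by rewrite !divr_gt0.
apply: le_trans (le_trans _ h) _; last lra.
rewrite (_ : _ * vol (ball x r) = vol (ball x r) / vol (ball x r) * (mass (ball x r) / 2)).
  by rewrite divff ?mul1r// gt_eqF.
lra.
Qed.

(** The first bound makes the mean at least [2 * l], so [vol_le_high] applies; the second, with
    reverse Hoelder, gives [w < Lam * l] almost everywhere on the ball. *)
Lemma vol_le_intermediate x r l : 0 < r -> 0 < l ->
  kap * l * vol (ball x r) <= D * mass (ball x r) ->
  mass (ball x r) <= kap * l * vol (ball x r) ->
  vol (ball x r) <=
    2 * CR * vol ((bball x r `&` sublevel (Lam * l)) `\` sublevel l).
Proof.
move=> r0 l0 hlo hhi.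
have v0 := vol_ball_gt0 Cd1 dbl x r0.
apply: (le_trans (vol_le_high r0 l0 _)).
  rewrite -(ler_pM2l D0); apply: le_trans hlo.
  rewrite /kap.
  have := mulr_gt0 D0 (mulr_gt0 l0 v0).
  have : 1 <= Cd ^+ 2 by rewrite exprn_ege1// ltW.
  move=> c1 dlv; have := ler_wpM2l (ltW dlv) c1; lra.
set H := _ `\` sublevel l; set G := _ `\` _.
have mH : measurable H by apply: measurableD => //; exact: measurable_sublevel.
have mG : measurable G.
  apply: measurableD; last exact: measurable_sublevel.
  by apply: measurableI => //; exact: measurable_sublevel.
rewrite ler_pM2l ?mulr_gt0// -lee_fin.
have Hx : H `<=` ball x r by move=> y [].
have GH : G `<=` H by move=> y [[]].
rewrite -(volE Cd1 dbl mH Hx) -(volE Cd1 dbl mG (subset_trans GH Hx)).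
suff HG0 : mu (H `\` G) = 0%E.
  have -> : mu H = (mu (H `\` G) + mu (H `&` G))%E := measureDI mu mH mG.
  by rewrite HG0 add0e setIidr.
have [N [mN N0 sN]] := RH x r0.
apply: (subset_measure0 _ mN) => //; first exact: measurableD.
move=> y [[xy yl] Gy]; apply: sN => /(_ xy) wy; apply: Gy; split=> //; split=> //.
apply: (le_lt_trans wy).
have : mass (ball x r) / vol (ball x r) <= kap * l by rewrite ler_pdivrMr.
move=> /(ler_wpM2l (ltW CR0)) /le_lt_trans; apply.
rewrite /Lam; have := mulr_gt0 CR0 (mulr_gt0 kap0 l0); lra.
Qed.

(* Halve the radius [s] until the average of [w] drops below [kap * l]; if it never
   does, take a ball so small that it lies in [U]. *)
Lemma exists_stopping_radius (U : set X) y s l : open U -> U y -> 0 < s -> 0 < l ->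
  kap * l * vol (ball y s) < mass (ball y s) ->
  exists r, [/\ 0 < r, r <= s &
    kap * l * vol (ball y r) <= D * mass (ball y r) /\
      mass (ball y r) <= kap * l * vol (ball y r) \/
    ball y r `<=` U /\ kap * l * vol (ball y r) < mass (ball y r)].
Proof.
move=> oU Uy s0 l0 hs; pose rk k : R := s / 2 ^+ k.
have rk0 k : 0 < rk k by rewrite divr_gt0// exprn_gt0.
have rks k : rk k <= s.
  by by rewrite ler_pdivrMr ?exprn_gt0// ler_peMr// ?exprn_ege1 ?ler1n// ltW.
have rkS k : rk k = 2 * rk k.+1.
  by rewrite /rk exprS invfM mulrCA mulVKf// pnatr_eq0.
pose P k := mass (ball y (rk k)) <= kap * l * vol (ball y (rk k)).
have [exP|noP] := pselect (exists k, P k).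
  case: (ex_minnP exP) => -[|n] Pn minP.
    by move: Pn; rewrite /P /rk expr0 divr1 leNgt hs.
  exists (rk n.+1); split=> //; left; split=> //.
  (* By minimality the ball of twice this radius is still above the threshold; [massD] passes that
     on at the cost of [D]. *)
  have := massD y (rk0 n.+1); rewrite -rkS; apply: le_trans.
  apply: (@le_trans _ _ (kap * l * vol (ball y (rk n)))).
    rewrite ler_pM2l ?mulr_gt0//; apply: (le_vol_ball Cd1 dbl).
    rewrite mdistxx add0r (rkS n); apply: ler_peMl; first exact: ltW.
    by rewrite ler1n.
  by rewrite ltW// ltNge; apply/negP => /minP; rewrite ltnn.
have /nbhs_ballP[d /= d0 dU] : nbhs y U by exact: open_nbhs_nbhs.
have [k hk] := exists_pow2_ge s d0.
exists (rk k); split=> //; right; split.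
  by apply: subset_trans dU; apply: le_ball; rewrite ler_pdivrMr ?exprn_gt0// mulrC.
by rewrite ltNge; apply/negP => Pk; apply: noP; exists k.
Qed.

(** With [v] the volume of the smaller sublevel set and [g] the volume gained, the next proof ends
    in [3 / 4 * v <= 2 * CR * Cd ^+ 2 * g + v / 2], that is [v <= gainV * g]. *)
Let gainV : R := 8 * CR * Cd ^+ 2.

(** Stopping radii are at most half the gap between the radii, so stopping balls centred in the
    small ball stay in the large one. The last hypothesis starts the stopping process above its
    threshold. The gain comes from points with [l <= w < Lam * l]. *)
Lemma sublevel_decay_step x0 rho rho' l : 0 < rho' -> rho' < rho -> 0 < l ->
  (forall y, ball x0 rho' y ->
     kap * l * vol (ball y ((rho - rho') / 2)) < mass (ball y ((rho - rho') / 2))) ->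
  (1 + gainV^-1) * vol (bball x0 rho' `&` sublevel l) <=
    vol (bball x0 rho `&` sublevel (Lam * l)).
Proof.
move=> rho'0 rho'rho l0; set s := (rho - rho') / 2 => start.
have s0 : 0 < s by rewrite divr_gt0// subr_gt0.
have rho0 : 0 < rho by exact: lt_trans rho'rho.
have Lam1 : 1 <= Lam.
  have c1 : 1 <= Cd ^+ 2 by rewrite exprn_ege1// ltW.
  have := mulr_ege1 CR1 (mulr_ege1 D1 c1); rewrite /Lam /kap; lra.
set E := _ `&` _; set F := _ `&` _.
have mE : measurable E by apply: measurableI => //; exact: measurable_sublevel.
have mF : measurable F by apply: measurableI => //; exact: measurable_sublevel.
have Fx : F `<=` ball x0 rho by move=> y [].
have EF : E `<=` F.
  move=> y [/= xy wy]; split; first by apply: le_ball xy; exact: ltW.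
  by apply: (lt_le_trans wy); rewrite ler_peMl// ltW.
have Ex := subset_trans EF Fx.
have mFE : measurable (F `\` E) by exact: measurableD.
have FEx : F `\` E `<=` ball x0 rho by move=> y [/Fx].
have volF : vol F = vol (F `\` E) + vol E.
  by rewrite (vol_split Cd1 dbl mF mE Fx) [F `&` E]setIidr.
set v := vol E in volF *.
have c20 : 0 < Cd ^+ 2 by rewrite exprn_gt0.
suff : v <= gainV * vol (F `\` E).
  rewrite -ler_pdivrMl ?mulr_gt0// volF mulrDl mul1r; lra.
have [v0|v0] := leP v 0.
  by apply: (le_trans v0); rewrite mulr_ge0 ?vol_ge0// ltW// !mulr_gt0.
set M := CR * (mass (ball x0 rho) / vol (ball x0 rho)).
have M0 : 0 < M.
  rewrite mulr_gt0// divr_gt0//; first exact: (mass_ball_gt0 dbl w0 mw iw wpos x0 rho0).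
  exact: (vol_ball_gt0 Cd1 dbl x0 rho0).
(* [e <= v / 4] leaves at least three quarters of [E] in [K]. As [M] bounds mass by volume inside
   the large ball, [M * e <= l * v] limits the mass of [U] outside [E]. *)
pose e := Num.min (v / 4) (l * v / M).
have e0 : 0 < e by rewrite lt_min !divr_gt0// mulr_gt0.
have ev : e <= v / 4 by rewrite ge_min lexx.
have eM : M * e <= l * v by rewrite mulrC -ler_pdivlMr// ge_min lexx orbT.
have [K [U [[cK oU] KE EU Ux UK]]] := compact_open_approx Cd1 dbl mE Ex rho0 e0.
have mK : measurable (K : set (borelType X)) by exact: measurable_compact.
have mU : measurable (U : set (borelType X)) by exact: measurable_open.
have volK : v - e <= vol K.
  have KE' : E `&` K = K by rewrite setIidr.
  rewrite /v (vol_split Cd1 dbl mE mK Ex) KE'.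
  suff /le_lt_trans/(_ UK) : vol (E `\` K) <= vol (U `\` K) by lra.
  apply: (@le_vol _ _ _ _ Cd1 dbl x0 rho); [exact: measurableD..| |].
  - exact: setSD.
  - by move=> y [/Ux].
have massU : mass U <= 2 * l * v.
  rewrite (mass_split w0 mw iw mU mE Ux) setIidr//.
  have mUE : measurable (U `\` E : set (borelType X)) by exact: measurableD.
  have UEx : U `\` E `<=` ball x0 rho by move=> y [/Ux].
  have h1 : mass (U `\` E) <= l * v.
    apply: le_trans (mass_le_vol rho0 mUE UEx) _; apply: le_trans eM.
    rewrite ler_pM2l//; apply: ltW; apply: le_lt_trans UK.
    apply: (@le_vol _ _ _ _ Cd1 dbl x0 rho) => //; first exact: measurableD.
    - exact: setDS.
    - by move=> y [/Ux].
  have h2 : mass E <= l * v.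
    apply: (mass_le_ae Cd1 dbl w0 mw iw mE Ex (ltW l0)).
    by apply: aeW => y [_ /ltW].
  lra.
pose good y r := kap * l * vol (ball y r) <= D * mass (ball y r) /\
      mass (ball y r) <= kap * l * vol (ball y r).
pose bad y r := ball y r `<=` U /\ kap * l * vol (ball y r) < mass (ball y r).
have /choice[r rP] : forall y, exists r, K y ->
    [/\ 0 < r, r <= s & good y r \/ bad y r].
  move=> y; have [Ky|nKy] := pselect (K y); last by exists 0.
  have [xy _] := KE y Ky.
  have [r rP] := exists_stopping_radius oU (EU _ (KE _ Ky)) s0 l0 (start y xy).
  by exists r.
(* Compactness leaves finitely many balls; the Vitali selection makes them disjoint while their
   fourfold enlargements still cover [K]. *)
have [|S [SK KS]] := @compact_finite_cover _ _ K r cK; first by move=> y /rP[].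
have [|t [ut tS dt ct]] := @vitali_finite _ _ [seq (y, r y) | y <- S].
  by move=> p /mapP[y /SK /rP[] + _ _] ->.
have tP q : q \in t -> [/\ ball x0 rho' q.1, 0 < q.2, q.2 <= s &
    good q.1 q.2 \/ bad q.1 q.2].
  by move=> /tS/mapP[y /SK Ky ->]; have [xy _] := KE _ Ky; have [] := rP _ Ky.
have Kx : K `<=` ball x0 rho := subset_trans KE Ex.
have Kcov : vol K <= Cd ^+ 2 * \sum_(q <- t) vol (ball q.1 q.2).
  have /(vol_le_sum_cover Cd1 dbl mK Kx)/le_trans : forall y, K y ->
      exists2 q, q \in t & ball q.1 (4 * q.2) y.
    move=> y /KS[z zS zy]; have [|q qt sub] := ct (z, r z).
      by apply/mapP; exists z.
    by exists q => //; exact: sub.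
  apply; rewrite mulr_sumr big_seq [leRHS]big_seq; apply: ler_sum => q /tP[_ q0 _ _].
  by rewrite (_ : 4 = 2 ^+ 2) ?(vol_double_iter Cd1 dbl)// -natrX.
pose b (q : X * R) := mass (ball q.1 q.2) <= kap * l * vol (ball q.1 q.2).
pose t1 := [seq q <- t | b q]; pose t2 := [seq q <- t | ~~ b q].
have {}Kcov : vol K <= Cd ^+ 2 * (\sum_(q <- t1) vol (ball q.1 q.2) +
    \sum_(q <- t2) vol (ball q.1 q.2)).
  by move: Kcov; rewrite (bigID b) /= !big_filter.
(* The bad balls are disjoint, lie in [U] and have mean above [kap * l]. *)
have S2 : kap * l * \sum_(q <- t2) vol (ball q.1 q.2) <= mass U.
  have t2t q : q \in t2 -> q \in t by rewrite mem_filter => /andP[].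
  have t2P q : q \in t2 -> bad q.1 q.2.
    by rewrite mem_filter => /andP[bq /tP[_ _ _ [[_ gq]|//]]]; rewrite /= /b gq in bq.
  rewrite mulr_sumr; apply: (@le_trans _ _ (\sum_(q <- t2) mass (ball q.1 q.2))).
    rewrite big_seq [leRHS]big_seq; apply: ler_sum => q /t2P[_ /ltW]//.
  apply: (mass_sum_disjoint w0 mw iw _ mU _ _ Ux).
  - exact: filter_uniq.
  - by move=> q; exact: measurable_mball.
  - by move=> q /t2P[].
  - by move=> p q /t2t pt /t2t qt; exact: dt.
(* Each good ball has a fixed share where [l <= w < Lam * l]; these shares are disjoint and lie in
   [F] outside [E]. *)
have S1 : \sum_(q <- t1) vol (ball q.1 q.2) <= 2 * CR * vol (F `\` E).
  have t1t q : q \in t1 -> q \in t by rewrite mem_filter => /andP[].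
  have t1P q : q \in t1 -> good q.1 q.2.
    by rewrite mem_filter => /andP[bq /tP[_ _ _ [//|[_]]]]; rewrite ltNge [_ <= _]bq.
  pose G (q : X * R) := (bball q.1 q.2 `&` sublevel (Lam * l)) `\` sublevel l.
  have Gq q : G q `<=` ball q.1 q.2 by move=> y [[]].
  apply: (@le_trans _ _ (2 * CR * \sum_(q <- t1) vol (G q))).
    rewrite mulr_sumr big_seq [leRHS]big_seq; apply: ler_sum => q qt1.
    have [_ q0 _ _] := tP q (t1t q qt1); have [g1 g2] := t1P q qt1.
    exact: vol_le_intermediate.
  rewrite ler_pM2l ?mulr_gt0//.
  apply: (vol_sum_disjoint Cd1 dbl _ mFE _ _ FEx).
  - exact: filter_uniq.
  - by move=> q; apply: measurableD; [apply: measurableI => //|];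
      exact: measurable_sublevel.
  - move=> q /t1t/tP[/in_ball xq q0 qs _] y [[qy hy] ly]; split; last by move=> [].
    split=> //; move: qy; apply: ball_subset; move: qs xq; rewrite /s /=; lra.
  - move=> p q /t1t pt /t1t qt pq; rewrite -subset0 => y [/Gq py /Gq qy].
    by rewrite -(dt p q pt qt pq).
move: S1 S2 Kcov; set A1 := \sum_(q <- t1) _; set A2 := \sum_(q <- t2) _.
move=> S1 S2 Kcov.
(* The value of [kap] enters here: [4 * D * Cd ^+ 2 * A2 <= 2 * v], and [1 <= D]. *)
have A2v : Cd ^+ 2 * A2 <= v / 2.
  have h : kap * l * A2 <= 2 * l * v by exact: le_trans massU.
  have : 2 * D * (Cd ^+ 2 * A2) <= v.
    by rewrite -(ler_pM2l (_ : 0 < 2 * l)) ?mulr_gt0//; move: h; rewrite /kap; lra.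
  have A20 : 0 <= Cd ^+ 2 * A2.
    by rewrite mulr_ge0 ?(ltW c20)//; apply: sumr_ge0 => q _; exact: vol_ge0.
  have := ler_wpM2r A20 D1; lra.
have := ler_wpM2l (ltW c20) S1; rewrite /gainV; lra.
Qed.

Lemma mass_double_iter n x r : 0 < r ->
  mass (ball x (2 ^+ n * r)) <= D ^+ n * mass (ball x r).
Proof.
move=> r0; elim: n => [|n IH]; first by rewrite !expr0 !mul1r.
rewrite !exprS -!mulrA; apply: le_trans (massD _ _) _.
  by rewrite mulr_gt0// exprn_gt0.
by rewrite ler_pM2l.
Qed.

(** Iterates [sublevel_decay_step] along radii decreasing from [2 * r] towards [r]. The mean on ever
    smaller starting balls falls at most by powers of [D], while the level falls by powers of
    [Lam >= 2 * D], so the start condition persists. *)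
Lemma sublevel_decay : exists c L theta : R,
  [/\ 0 < c, 1 < L, 0 < theta < 1 & forall x r i, 0 < r ->
     vol (bball x r `&` sublevel (c * (mass (ball x r) / vol (ball x r)) / L ^+ i))
       <= theta ^+ i * (Cd * vol (ball x r))].
Proof.
have c20 : 0 < Cd ^+ 2 by rewrite exprn_gt0.
have c21 : 1 <= Cd ^+ 2 by rewrite exprn_ege1// ltW.
have LamD : 2 * D <= Lam.
  have := ler_wpM2l (ltW D0) (mulr_ege1 CR1 c21); rewrite /Lam /kap; move: D0; lra.
have Lam1 : 1 < Lam by move: D1; lra.
have Lam0 : 0 < Lam by exact: lt_trans Lam1.
have vs0 : 0 < gainV^-1 by rewrite invr_gt0 !mulr_gt0.
pose theta := (1 + gainV^-1)^-1.
have th0 : 0 < theta by rewrite invr_gt0 addr_gt0.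
(* Meets the start condition with a factor 2 to spare: [kap] is the threshold, [Cd ^+ 2] compares
   volumes, and [D ^+ 3] is the excess of [i.+4] mass doublings over [i.+1] levels. *)
pose c := (2 * kap * Cd ^+ 2 * D ^+ 3)^-1.
have c0 : 0 < c by rewrite invr_gt0 !mulr_gt0// exprn_gt0.
exists c, Lam, theta; split=> //.
  by rewrite th0 invf_lt1 ?addr_gt0// ltrDl.
move=> x r i r0; set B := ball x r.
have m0 : 0 < mass B := mass_ball_gt0 dbl w0 mw iw wpos x r0.
have v0 : 0 < vol B := vol_ball_gt0 Cd1 dbl x r0.
set a := mass B / vol B; have a0 : 0 < a by rewrite divr_gt0.
have aB : a * vol B = mass B by rewrite divfK// gt_eqF.
(* The radii shrink at the rate at which stopping balls do. *)
pose rho j : R := r + r / 2 ^+ j.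
have rj0 j : 0 < r / 2 ^+ j by rewrite divr_gt0// exprn_gt0.
have rjS j : r / 2 ^+ j = 2 * (r / 2 ^+ j.+1).
  by rewrite exprS invfM mulrCA mulVKf// pnatr_eq0.
(* The induction runs on the balls of radius [rho i], all of which contain [ball x r]. *)
suff : vol (bball x (rho i) `&` sublevel (c * a / Lam ^+ i)) <=
    theta ^+ i * (Cd * vol B).
  move=> h; apply: le_trans h; apply: (@le_vol _ _ _ _ Cd1 dbl x (rho i)).
  - by apply: measurableI; [exact: mB|exact: measurable_sublevel].
  - by apply: measurableI; [exact: mB|exact: measurable_sublevel].
  - by move=> y [xy ?]; split=> //; apply: le_ball xy; rewrite lerDl ltW.
  - by move=> y [].
elim: i => [|i IH].
  (* [rho 0] is [2 * r], whence the factor [Cd] in the bound. *)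
  rewrite expr0 mul1r; apply: le_trans (vol_double Cd1 dbl x r0).
  rewrite (_ : 2 * r = rho 0%N); last by rewrite /rho expr0; lra.
  apply: (@le_vol _ _ _ _ Cd1 dbl x (rho 0%N)) => //.
  by apply: measurableI; [exact: mB|exact: measurable_sublevel].
have li0 : 0 < c * a / Lam ^+ i.+1 by apply: divr_gt0; [exact: mulr_gt0|exact: exprn_gt0].
have : (1 + gainV^-1) * vol (bball x (rho i.+1) `&` sublevel (c * a / Lam ^+ i.+1))
    <= vol (bball x (rho i) `&` sublevel (Lam * (c * a / Lam ^+ i.+1))).
  apply: sublevel_decay_step => //.
  - by rewrite addr_gt0.
  - by rewrite /rho ltrD2l (rjS i); have := rj0 i.+1; lra.
  move=> y /in_ball xy.
  have -> : (rho i - rho i.+1) / 2 = r / 2 ^+ i.+2.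
    by rewrite /rho (rjS i) (rjS i.+1); lra.
  set b := ball y _.
  have xy2 : mdist x y < 2 * r.
    apply: (lt_le_trans xy); rewrite /rho.
    have : r / 2 ^+ i.+1 <= r.
      by rewrite ler_pdivrMr ?exprn_gt0// ler_peMr// ?exprn_ege1 ?ler1n// ltW.
    lra.
  have vb : vol b <= Cd ^+ 2 * vol B.
    apply: le_trans (vol_double_iter Cd1 dbl 2 x r0).
    apply: (le_vol_ball Cd1 dbl).
    have := rjS i.+1; have := rjS i; have : r / 2 ^+ i <= r.
      by rewrite ler_pdivrMr ?exprn_gt0// ler_peMr// ?exprn_ege1 ?ler1n// ltW.
    rewrite -natrX; move: xy2; lra.
  (* [B] lies in [ball y (4 * r)], and [4 * r] is [2 ^+ i.+4] times the radius of [b]. *)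
  have mb : mass B <= D ^+ i.+4 * mass b.
    apply: le_trans (mass_double_iter i.+4 y (rj0 i.+2)).
    apply: (le_mass w0 mw iw (mB _ _) (mB _ _) _ (@subset_refl _ _)).
    apply: ball_subset.
    have -> : 2 ^+ i.+4 * (r / 2 ^+ i.+2) = 4 * r.
      rewrite -[i.+4]/(2 + i.+2)%N exprD -mulrA (mulrC _ (r / _)) divfK; last first.
        by rewrite expf_neq0// pnatr_eq0.
      by rewrite -natrX mulrC.
    rewrite metric_sym; lra.
  have mb0 : 0 < mass b := mass_ball_gt0 dbl w0 mw iw wpos y (rj0 i.+2).
  apply: (@le_lt_trans _ _ (mass b / 2)); last by lra.
  apply: (@le_trans _ _ (kap * (c * a / D ^+ i.+1) * (Cd ^+ 2 * vol B))).
    apply: ler_pM => //; [by rewrite mulr_ge0 ?ltW//|exact: vol_ge0|].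
    rewrite ler_pM2l// ler_pM2l; last exact: mulr_gt0.
    rewrite lef_pV2 ?posrE; [|exact: exprn_gt0..].
    by apply: lerXn2r; rewrite ?nnegrE ?ltW//; move: LamD D0; lra.
  rewrite (_ : _ * _ = kap * c / D ^+ i.+1 * Cd ^+ 2 * (a * vol B)); last lra.
  rewrite aB.
  apply: (@le_trans _ _ (kap * c / D ^+ i.+1 * Cd ^+ 2 * (D ^+ i.+4 * mass b))).
    by rewrite ler_pM2l// !mulr_gt0// ?invr_gt0 exprn_gt0.
  rewrite -[i.+4]/(3 + i.+1)%N exprD.
  rewrite (_ : _ * _ = kap * Cd ^+ 2 * D ^+ 3 * c * (D ^+ i.+1 / D ^+ i.+1) * mass b).
    rewrite divff ?mulr1; last by rewrite gt_eqF// exprn_gt0.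
    rewrite (_ : _ * c = 2^-1); first by lra.
    rewrite /c (_ : 2 * kap * Cd ^+ 2 * D ^+ 3 = 2 * (kap * Cd ^+ 2 * D ^+ 3)).
      rewrite invfM mulrCA divff ?mulr1//.
      by rewrite gt_eqF// !mulr_gt0// exprn_gt0.
    by rewrite !mulrA.
  lra.
have -> : Lam * (c * a / Lam ^+ i.+1) = c * a / Lam ^+ i.
  by rewrite exprS invfM mulrCA mulVKf// gt_eqF.
move=> /le_trans/(_ IH); rewrite -ler_pdivlMl ?addr_gt0// => /le_trans; apply.
by rewrite exprS -mulrA.
Qed.

End level_sets.

End reverse_holder.

(** * Integrals and averages over balls *)

(** Essential bounds on a ball are defined through the restricted measure, whereas the estimates
    hold almost everywhere for [mu]; this links the two. *)
Lemma ae_mrestr d (T : measurableType d) (R : realType)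
    (mu : {measure set T -> \bar R}) (D : set T) (mD : measurable D) (P : T -> Prop) :
  {ae mrestr mu mD, forall x, P x} <-> {ae mu, forall x, D x -> P x}.
Proof.
split=> -[N [mN N0 sN]].
  exists (N `&` D); split=> //; first exact: measurableI.
  by move=> x /= /not_implyP[Dx nPx]; split=> //; exact: sN.
exists (N `|` ~` D); split.
- by apply: measurableU => //; exact: measurableC.
- rewrite /= /mrestr setIUl setICl setU0; apply: (subset_measure0 _ mN) => //.
  exact: measurableI.
- move=> x /= nPx; have [Dx|] := pselect (D x); last by right.
  by left; apply: sN => /= /(_ Dx).
Qed.

Section integrals.
Context d (T : measurableType d) (R : realType).
Variable mu : {measure set T -> \bar R}.
Variable D : set T.
Hypothesis mD : measurable D.
Implicit Types f g : T -> R.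
Local Notation I f := (fine (\int[mu]_(x in D) (f x)%:E)).

Lemma integrable_ae_le f g : measurable_fun D f ->
  mu.-integrable D (EFin \o g) -> {ae mu, forall x, D x -> `|f x| <= g x} ->
  mu.-integrable D (EFin \o f).
Proof.
move=> mf /integrableP[/measurable_EFinP mg goo] fg.
apply/integrableP; split; first exact/measurable_EFinP.
apply: le_lt_trans goo; apply: ae_ge0_le_integral => //.
- by apply/measurable_EFinP; apply: measurableT_comp.
- by apply/measurable_EFinP; apply: measurableT_comp.
- by apply: filterS fg => x /[apply] h; rewrite lee_fin (le_trans h)// ler_norm.
Qed.

Lemma le_fine_integral_ae f g : mu.-integrable D (EFin \o f) ->
  mu.-integrable D (EFin \o g) -> {ae mu, forall x, D x -> f x <= g x} ->
  I f <= I g.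
Proof.
move=> fi gi fg; rewrite -subr_ge0 -lee_fin EFinB !fineK ?integrable_fin_num//.
rewrite -integralB_EFin//.
have mf : measurable_fun D f by have /integrableP[/measurable_EFinP] := fi.
have mg : measurable_fun D g by have /integrableP[/measurable_EFinP] := gi.
(* [g - f] is known to be nonnegative only almost everywhere; its absolute value is so
   everywhere. *)
rewrite (ae_eq_integral (fun x => `|g x - f x|%:E))//.
- by apply: integral_ge0 => x _; rewrite lee_fin.
- by apply/measurable_EFinP; apply: measurable_funB.
- by apply/measurable_EFinP; apply: measurableT_comp => //; apply: measurable_funB.
- by apply: filterS fg => x h Dx; rewrite ger0_norm ?subr_ge0 ?h// EFinB.
Qed.

Hypothesis Doo : (mu D < +oo)%E.

Lemma integrable_cstr (c : R) : mu.-integrable D (EFin \o cst c).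
Proof.
apply/integrableP; split; first exact/measurable_EFinP.
rewrite /= (integral_cst mu mD) lte_mul_pinfty// ?lee_fin//.
Qed.

Lemma integrable_affine f (k c : R) : mu.-integrable D (EFin \o f) ->
  mu.-integrable D (EFin \o (fun x => k * f x + c)).
Proof.
move=> fi; have := integrableD mD (integrableZl mD k fi) (integrable_cstr c).
by apply: eq_integrable => // x _ /=; rewrite EFinD EFinM.
Qed.

Lemma fine_integral_affine f (k c : R) : mu.-integrable D (EFin \o f) ->
  I (fun x => k * f x + c) = k * I f + c * fine (mu D).
Proof.
move=> fi; apply: EFin_inj; rewrite EFinD !EFinM !fineK ?integrable_fin_num//.
- under eq_integral do rewrite EFinD EFinM.
  rewrite integralD//; last 2 first.
  + exact: integrableZl.
  + exact: integrable_cstr.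
  by rewrite integralZl// integral_cst.
- by rewrite ge0_fin_numE.
- exact: integrable_affine.
Qed.

End integrals.

(** * Local integrability and essential bounds on balls *)

Section local_integrability.
Context {R : realType} {X : completeMetricType R}.
Variable mu : {measure set (borelType X) -> \bar R}.
Implicit Types (x y z : X) (r : R) (f w : X -> R).
Variable Cd : R.
Hypothesis Cd1 : 1 < Cd.
Hypothesis dbl : forall x r, 0 < r ->
  [/\ (0 < mu (ball x (2 * r)%R))%E,
      (mu (ball x (2 * r)%R) <= Cd%:E * mu (ball x r))%E &
      (Cd%:E * mu (ball x r) < +oo)%E].
Local Notation vol := (vol mu).
Local Notation mass := (mass mu).

Let mB x r : measurable (ball x r : set (borelType X)) := measurable_mball x r.

(** The closed ball is compact and contains the open one; for [r <= 0] the ball is empty. *)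
Lemma L1loc_ball f x r : L1loc mu f -> mu.-integrable (ball x r) (EFin \o f).
Proof.
move=> /(_ (closed_ball x `|r|)) fi.
have [r0|r0] := ltP 0 r; last first.
  rewrite (_ : ball x r = set0); first exact: integrable_set0.
  rewrite -subset0 => y /in_ball.
  by move=> /lt_le_trans/(_ r0); rewrite ltNge mdist_ge0.
have {}fi := fi (compact_closed_ball Cd1 dbl _).
apply: (integrableS _ (mB x r) _ (fi _)).
- by apply: measurable_closed; exact: closed_closure.
- by rewrite gtr0_norm//; exact: subset_closure.
- by rewrite gtr0_norm.
Qed.

Lemma ball_L1loc f : (forall x r, 0 < r -> mu.-integrable (ball x r) (EFin \o f)) ->
  L1loc mu f.
Proof.
move=> fi K cK; have [[x Kx]|K0] := pselect (K !=set0); last first.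
  rewrite (_ : K = set0); first exact: integrable_set0.
  by apply: contrapT => /eqP/set0P.
have [r r0 Kr] := compact_subset_ball x cK.
by apply: (integrableS (mB x r) (measurable_compact cK) Kr); exact: fi.
Qed.

Lemma L1loc_measurable f : L1loc mu f -> measurable_fun setT (f : borelType X -> R).
Proof.
move=> fL; have [[x _]|X0] := pselect (exists x : X, True); last first.
  rewrite (_ : setT = set0); first exact: measurable_fun_set0.
  by rewrite -subset0 => x _; apply: X0; exists x.
have -> : setT = \bigcup_n (ball x n%:R : set (borelType X)).
  apply/esym; rewrite -subTset => y _; exists (Num.truncn (mdist x y)).+1 => //.
  by apply/in_ball; exact: truncnS_gt.
apply/measurable_fun_bigcup => [n|n]; first exact: mB.
by have /integrableP[/measurable_EFinP] := L1loc_ball x n%:R fL.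
Qed.

Lemma avgE f x r : 0 < r -> L1loc mu f ->
  avg mu x r f = (mass f (ball x r) / vol (ball x r))%:E.
Proof.
move=> r0 fL; have v0 := vol_ball_gt0 Cd1 dbl x r0.
rewrite /avg (vol_ballE Cd1 dbl) inver gt_eqF// muleC EFinM fineK//.
by apply: integrable_fin_num => //; exact: L1loc_ball.
Qed.

Lemma ess_sup_ballP f x r (M : \bar R) :
  (ess_sup_ball mu x r f <= M)%E <->
  {ae mu, forall y : borelType X, ball x r y -> ((f y)%:E <= M)%E}.
Proof.
rewrite /ess_sup_ball; split.
  by move=> /ess_supP/ae_mrestr.
by move=> h; apply/ess_supP/ae_mrestr.
Qed.

Lemma ess_inf_ballP f x r (M : \bar R) :
  (M <= ess_inf_ball mu x r f)%E <->
  {ae mu, forall y : borelType X, ball x r y -> (M <= (f y)%:E)%E}.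
Proof.
rewrite /ess_inf_ball; split.
  by move=> /ess_infP/ae_mrestr.
by move=> h; apply/ess_infP/ae_mrestr.
Qed.

Lemma ae_ball_exists x r (P : borelType X -> Prop) : 0 < r ->
  {ae mu, forall y : borelType X, ball x r y -> P y} -> exists2 y, ball x r y & P y.
Proof.
move=> r0 [N [mN N0 sN]]; apply: contrapT => nP.
have := mu_ball_gt0 dbl x r0; rewrite (subset_measure0 (mB x r) mN) ?ltxx//.
by move=> y xy; apply: sN => /= /(_ xy) Py; apply: nP; exists y.
Qed.

Lemma ess_inf_ball_lty f x r : 0 < r -> (ess_inf_ball mu x r f < +oo)%E.
Proof.
move=> r0; rewrite ltey; apply/eqP => iy.
have /ess_inf_ballP/(ae_ball_exists r0)[y _] : (+oo <= ess_inf_ball mu x r f)%E.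
  by rewrite iy.
by [].
Qed.

End local_integrability.

Lemma ereal_sup_bounded {R : realType} (S : set (\bar R)) : (ereal_sup S < +oo)%E ->
  exists2 K : R, 0 < K & forall s, S s -> (s <= K%:E)%E.
Proof.
move=> Soo; exists (Num.max 1 (fine (ereal_sup S))); first by rewrite lt_max ltr01.
move=> s Ss; have := ereal_sup_ubound Ss.
case: (ereal_sup S) Soo => [k| |]//= _ sk.
  by apply: le_trans sk _; rewrite lee_fin le_max lexx orbT.
by apply: le_trans sk _; rewrite leNye.
Qed.

(** The tangent line at [a] lies above the concave function [ln]; averaging it gives Jensen's
    inequality. *)
Lemma ln_le_tangent {R : realType} (a t : R) : 0 < a -> 0 < t ->
  ln t <= a^-1 * t + (ln a - 1).
Proof.
move=> a0 t0; have ta : 0 < a^-1 * t by rewrite mulr_gt0 ?invr_gt0.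
have := @le_ln1Dx R (a^-1 * t - 1); rewrite [1 + _]addrC subrK lnM ?posrE ?invr_gt0//.
rewrite lnV ?posrE//; lra.
Qed.

(** * Means of weights, the characterization of A_1, and the passage from BUO to RH_oo *)

Section weights.
Context {R : realType} {X : completeMetricType R}.
Variable mu : {measure set (borelType X) -> \bar R}.
Implicit Types (x y z : X) (r : R) (f w : X -> R).
Variable Cd : R.
Hypothesis Cd1 : 1 < Cd.
Hypothesis dbl : forall x r, 0 < r ->
  [/\ (0 < mu (ball x (2 * r)%R))%E,
      (mu (ball x (2 * r)%R) <= Cd%:E * mu (ball x r))%E &
      (Cd%:E * mu (ball x r) < +oo)%E].
Local Notation vol := (vol mu).
Local Notation mass := (mass mu).

Definition mean f x r : R := mass f (ball x r) / vol (ball x r).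

Let mB x r : measurable (ball x r : set (borelType X)) := measurable_mball x r.
Let Boo x r : (mu (ball x r) < +oo)%E := mu_ball_lty Cd1 dbl x r.


Lemma le_mean f g x r : 0 < r -> mu.-integrable (ball x r) (EFin \o f) ->
  mu.-integrable (ball x r) (EFin \o g) ->
  {ae mu, forall y : borelType X, ball x r y -> f y <= g y} ->
  mean f x r <= mean g x r.
Proof.
move=> r0 fi gi fg; rewrite /mean ler_pM2r ?invr_gt0 ?(vol_ball_gt0 Cd1 dbl)//.
exact: (@le_fine_integral_ae _ (borelType X) R mu _ (mB x r) f g).
Qed.

Lemma mean_affine f x r k c : 0 < r -> mu.-integrable (ball x r) (EFin \o f) ->
  mean (fun y => k * f y + c) x r = k * mean f x r + c.
Proof.
move=> r0 fi; rewrite /mean.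
have -> : mass (fun y => k * f y + c) (ball x r) =
    k * mass f (ball x r) + c * vol (ball x r).
  exact: (@fine_integral_affine _ (borelType X) R mu _ (mB x r) (Boo x r) f k c fi).
rewrite mulrDl -!mulrA divff ?mulr1// gt_eqF//; exact: (vol_ball_gt0 Cd1 dbl).
Qed.

Lemma le_mean_cst f x r c : 0 < r -> mu.-integrable (ball x r) (EFin \o f) ->
  {ae mu, forall y : borelType X, ball x r y -> c <= f y} -> c <= mean f x r.
Proof.
move=> r0 fi cf; rewrite -[leLHS]add0r -[0](mul0r (mean f x r)) -mean_affine//.
apply: le_mean => //.
  exact: (@integrable_affine _ (borelType X) R mu _ (mB x r) (Boo x r) f 0 c fi).
by apply: filterS cf => y /[apply]; rewrite mul0r add0r.
Qed.

Lemma jensen_log w x r : 0 < r -> L1loc mu w -> L1loc mu (log w) ->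
  {ae mu, forall y : borelType X, 0 < w y} -> 0 < mean w x r ->
  mean (log w) x r <= ln (mean w x r).
Proof.
move=> r0 wL lL wpos m0.
have wi := L1loc_ball Cd1 dbl x r wL.
(* The tangent line is taken at the mean of [w], so that its own mean is [ln (mean w x r)]. *)
have -> : ln (mean w x r) =
    mean (fun y => (mean w x r)^-1 * w y + (ln (mean w x r) - 1)) x r.
  by rewrite mean_affine// mulVf ?gt_eqF//; lra.
apply: le_mean => //.
- exact: (L1loc_ball Cd1 dbl x r lL).
- exact: (@integrable_affine _ (borelType X) R mu _ (mB x r) (Boo x r) w _ _ wi).
- by apply: filterS wpos => y wy _; exact: ln_le_tangent.
Qed.

Lemma weight_gt0_ae w : weight mu w -> {ae mu, forall y : borelType X, 0 < w y}.
Proof. by case. Qed.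

Lemma mean_weight_gt0 w x r : 0 < r -> weight mu w -> 0 < mean w x r.
Proof.
move=> r0 [w0 wL wpos]; rewrite /mean divr_gt0 ?(vol_ball_gt0 Cd1 dbl)//.
apply: (mass_ball_gt0 dbl w0 (L1loc_measurable Cd1 dbl wL) _ wpos x r0).
by move=> z s; exact: (L1loc_ball Cd1 dbl z s wL).
Qed.

Lemma measurable_log w : L1loc mu w ->
  measurable_fun setT (log w : borelType X -> R).
Proof.
by move=> wL; apply: measurableT_comp; [exact: measurable_ln|
  exact: (L1loc_measurable Cd1 dbl wL)].
Qed.

(** Only the lower bound is at stake: [ln (w y) <= w y] controls the positive part, so [w + |g|] is
    an integrable majorant. *)
Lemma L1loc_log w : weight mu w ->
  (forall x r, 0 < r -> exists2 g : X -> R, mu.-integrable (ball x r) (EFin \o g) &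
    {ae mu, forall y : borelType X, ball x r y -> - ln (w y) <= g y}) ->
  L1loc mu (log w).
Proof.
move=> ww lb; have [w0 wL _] := ww; have wpos := weight_gt0_ae ww; apply: ball_L1loc => x r r0.
have wi := L1loc_ball Cd1 dbl x r wL; have [g gi wg] := lb x r r0.
have gi' := integrable_abse gi.
have hi : mu.-integrable (ball x r) (EFin \o (fun y => w y + `|g y|)).
  exact: eq_integrable (integrableD (mB x r) wi gi').
apply: (@integrable_ae_le _ (borelType X) R mu _ (mB x r) (log w)
  (fun y => w y + `|g y|)) => //.
  by apply: measurable_funTS; exact: measurable_log.
apply: filterS2 wpos wg => y wy gy xy.
rewrite ler_norml /log; have := gy xy; have := ler_norm (g y).
have := ln_sublinear wy; have := normr_ge0 (g y); lra.
Qed.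

(** With [m] the essential infimum of [w], [ln m <= mean (log w) x r <= ln (mean w x r)]. The A_1
    condition bounds the gap between the ends; A_infinity and BLO bound the two successive gaps. *)
Lemma A1_characterization :
  A1 mu = [set w | Ainfty mu w /\ BLO mu (log w)].
Proof.
apply/seteqP; split=> w.
- move=> [ww [C A1w]]; have [w0 wL _] := ww; have wpos := weight_gt0_ae ww.
  (* If the essential infimum vanished, the A_1 inequality would force the positive mean of [w] to
     be at most 0. *)
  have inf_w x r : 0 < r -> exists m, [/\ 0 < m, ess_inf_ball mu x r w = m%:E,
      mean w x r <= C * m & {ae mu, forall y : borelType X, ball x r y -> m <= w y}].
    move=> r0; have := A1w x r r0; rewrite (avgE Cd1 dbl)//.
    have a0 := mean_weight_gt0 x r0 ww.
    have I0 : (0 <= ess_inf_ball mu x r w)%E.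
      by apply/ess_inf_ballP; apply: aeW => y _; rewrite lee_fin.
    have Ioo := ess_inf_ball_lty dbl w x r0.
    have [m Im] : exists m, ess_inf_ball mu x r w = m%:E.
      by move: I0 Ioo; case: (ess_inf_ball _ _ _ _) => // m; exists m.
    rewrite Im -EFinM lee_fin => aC; move: I0; rewrite Im lee_fin => m0.
    have m_gt0 : 0 < m.
      rewrite lt_neqAle m0 andbT; apply/eqP => m00.
      by move: aC; rewrite -m00 mulr0 leNgt a0.
    exists m; split=> //.
    have /ess_inf_ballP : (m%:E <= ess_inf_ball mu x r w)%E by rewrite Im.
    by apply: filterS => y /[apply]; rewrite lee_fin.
  have lL : L1loc mu (log w).
    apply: L1loc_log => // x r r0; have [m [m0 _ _ wm]] := inf_w x r r0.
    exists (cst (- ln m)); first exact: (integrable_cstr (mB x r) (Boo x r)).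
    by apply: filterS wm => y /[apply] my; rewrite lerN2 ler_ln ?posrE// (lt_le_trans m0).
  have log_inf x r m : 0 < m ->
      {ae mu, forall y : borelType X, ball x r y -> m <= w y} ->
      {ae mu, forall y : borelType X, ball x r y -> ln m <= log w y}.
    move=> m0; apply: filterS => y /[apply] my.
    by rewrite ler_ln ?posrE// (lt_le_trans m0).
  split; last split=> //.
  + split=> //; apply: (@le_lt_trans _ _ C%:E); last exact: ltry.
    apply: ge_ereal_sup => _ [x [r [r0 ->]]].
    have [m [m0 _ aC wm]] := inf_w x r r0.
    rewrite !(avgE Cd1 dbl)// -/(mean w x r) -/(mean (log w) x r) -EFinN /= -EFinM lee_fin.
    have a0 := mean_weight_gt0 x r0 ww.
    have lm : ln m <= mean (log w) x r.
      by apply: le_mean_cst => //; [exact: (L1loc_ball Cd1 dbl x r lL)|exact: log_inf].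
    apply: (@le_trans _ _ (mean w x r * expR (- ln m))).
      by rewrite ler_pM2l// ler_expR lerN2.
    by rewrite expRN lnK ?posrE// ler_pdivrMr.
  + apply: (@le_lt_trans _ _ (ln C)%:E); last exact: ltry.
    apply: ge_ereal_sup => _ [x [r [r0 ->]]].
    have [m [m0 _ aC wm]] := inf_w x r r0.
    have a0 := mean_weight_gt0 x r0 ww.
    have C0 : 0 < C.
      by have := lt_le_trans a0 aC; rewrite pmulr_lgt0.
    rewrite (avgE Cd1 dbl)// -/(mean (log w) x r).
    have : ((ln m)%:E <= ess_inf_ball mu x r (log w))%E.
      by apply/ess_inf_ballP; exact: log_inf.
    have := ess_inf_ball_lty dbl (log w) x r0.
    case: (ess_inf_ball _ _ _ _) => [i| |]//= _; rewrite -?EFinB !lee_fin => mi.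
    have := jensen_log r0 wL lL wpos a0.
    have : ln (mean w x r) <= ln (C * m) by rewrite ler_ln ?posrE// (lt_le_trans a0).
    rewrite lnM ?posrE//; lra.
- move=> [[ww /ereal_sup_bounded[K1 K10 hK1]] [lL /ereal_sup_bounded[K2 K20 hK2]]].
  have [w0 wL _] := ww; have wpos := weight_gt0_ae ww.
  (* A_infinity gives [mean w x r <= K1 * expR (mean (log w) x r)]; BLO bounds that mean of [log w]
     by its essential infimum plus [K2]. *)
  split=> //; exists (K1 * expR K2) => x r r0.
  have a0 := mean_weight_gt0 x r0 ww.
  have h1 : mean w x r <= K1 * expR (mean (log w) x r).
    have /hK1 : exists x' r', 0 < r' /\ (avg mu x r w * expeR (- avg mu x r (log w)))%E =
      (avg mu x' r' w * expeR (- avg mu x' r' (log w)))%E by exists x, r.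
    rewrite !(avgE Cd1 dbl)// -/(mean w x r) -/(mean (log w) x r) -EFinN /= -EFinM lee_fin.
    by rewrite expRN ler_pdivrMr// expR_gt0.
  have h2 : ((mean (log w) x r - K2)%:E <= ess_inf_ball mu x r (log w))%E.
    have /hK2 : exists x' r', 0 < r' /\
      (avg mu x r (log w) - ess_inf_ball mu x r (log w))%E =
      (avg mu x' r' (log w) - ess_inf_ball mu x' r' (log w))%E by exists x, r.
    rewrite (avgE Cd1 dbl)// -/(mean (log w) x r).
    by case: (ess_inf_ball _ _ _ _) => [i| |]//=; rewrite -?EFinB ?leey ?lee_fin//; lra.
  rewrite (avgE Cd1 dbl)// -/(mean w x r).
  apply: (@le_trans _ _ (K1 * expR K2 * expR (mean (log w) x r - K2))%:E).
    rewrite lee_fin; apply: le_trans h1 _; rewrite -mulrA -expRD.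
    by rewrite (_ : K2 + _ = mean (log w) x r)//; lra.
  rewrite EFinM; apply: lee_wpmul2l; first by rewrite lee_fin mulr_ge0 ?expR_ge0 ?ltW.
  apply/ess_inf_ballP; move/ess_inf_ballP: h2 => h2.
  apply: filterS2 wpos h2 => y wy ly xy; have := ly xy.
  by rewrite !lee_fin => h; rewrite -[leRHS]lnK ?posrE// ler_expR.
Qed.

(** Almost everywhere on the ball [w <= expR (K + mean (log w) x r)], and Jensen replaces the
    exponential of the mean of [log w] by the mean of [w]. *)
Lemma BUO_RHinfty w : weight mu w -> BUO mu (log w) -> RHinfty mu w.
Proof.
move=> ww [lL /ereal_sup_bounded[K K0 hK]]; have [w0 wL _] := ww; have wpos := weight_gt0_ae ww.
split=> //; exists (expR K) => x r r0.
have a0 := mean_weight_gt0 x r0 ww.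
have hs : (ess_sup_ball mu x r (log w) <= (mean (log w) x r + K)%:E)%E.
  have /hK : exists x' r', 0 < r' /\
    (ess_sup_ball mu x r (log w) - avg mu x r (log w))%E =
    (ess_sup_ball mu x' r' (log w) - avg mu x' r' (log w))%E by exists x, r.
  rewrite (avgE Cd1 dbl)// -/(mean (log w) x r).
  by case: (ess_sup_ball _ _ _ _) => [i| |]//=; rewrite -?EFinB ?leNye ?lee_fin//; lra.
rewrite (avgE Cd1 dbl)// -/(mean w x r) -EFinM.
apply/ess_sup_ballP; move/ess_sup_ballP: hs => hs.
apply: filterS2 wpos hs => y wy ly xy; have := ly xy.
rewrite !lee_fin => h; rewrite -[leLHS]lnK ?posrE//.
apply: (@le_trans _ _ (expR (K + ln (mean w x r)))); last by rewrite expRD lnK ?posrE.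
by rewrite ler_expR; have := jensen_log r0 wL lL (weight_gt0_ae ww) a0; move: h; rewrite /log; lra.
Qed.

End weights.

(* Layer-cake estimate: [(ln t - ln w)^+] is at most [ln L] times the number of
   levels [t / L ^ i] lying above [w]. *)
Lemma log_deficit_integrable d (T : measurableType d) (R : realType)
    (mu : {measure set T -> \bar R}) (D : set T) (w : T -> R) (t L theta V : R) :
  measurable D -> measurable_fun setT w -> {ae mu, forall y, 0 < w y} ->
  0 < t -> 1 < L -> 0 < theta < 1 -> 0 <= V ->
  (forall i, (mu (D `&` [set y | w y < t / L ^+ i]%R) <= (theta ^+ i * V)%:E)%E) ->
  let g y := Num.max 0 (ln t - ln (w y)) in
  mu.-integrable D (EFin \o g) /\
  fine (\int[mu]_(y in D) (g y)%:E) <= ln L * V / (1 - theta).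
Proof.
move=> mD mw wpos t0 L1 /andP[th0 th1] V0 decay g.
have L0 : 0 < L by exact: lt_trans L1.
have lL0 : 0 < ln L by exact: ln_gt0.
pose S i := [set y | w y < t / L ^+ i].
have mS i : measurable (S i).
  rewrite (_ : S i = setT `&` w @^-1` `]-oo, t / L ^+ i[%classic).
    exact: mw.
  by rewrite setTI; apply/seteqP; split=> y /=; rewrite in_itv.
pose f i y : \bar R := (ln L * \1_(S i) y)%:E.
have f0 i y : D y -> (0 <= f i y)%E.
  by move=> _; rewrite lee_fin mulr_ge0// ltW.
have mf i : measurable_fun D (f i).
  apply/measurable_EFinP; apply: measurable_funM; first exact: measurable_cst.
  exact: measurable_indic.
pose u y : \bar R := (\sum_(i <oo) f i y)%E.
have mu_ : measurable_fun D u by apply: ge0_emeasurable_sum => // *; exact: f0.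
have u0 y : D y -> (0 <= u y)%E by move=> Dy; apply: nneseries_ge0 => i _ _; exact: f0.
have intu : (\int[mu]_(y in D) u y <= (ln L * V / (1 - theta))%:E)%E.
  rewrite integral_nneseries//.
  apply: lime_le.
    by apply: is_cvg_nneseries => i _ _; apply: integral_ge0; exact: f0.
  apply: nearW => n.
  apply: (@le_trans _ _ (\sum_(0 <= i < n) (ln L * V * theta ^+ i)%:E)%E).
    apply: lee_sum => i _; rewrite /f.
    under eq_integral do rewrite EFinM.
    rewrite ge0_integralZl//; last 2 first.
    - by apply/measurable_EFinP; exact: measurable_indic.
    - by rewrite lee_fin ltW.
    rewrite integral_indic// setIC -mulrA EFinM lee_pmul2l ?lte_fin//.
    by rewrite mulrC decay.
  rewrite sumEFin lee_fin; apply: geometric_le_lim => //.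
    by rewrite mulr_ge0// ltW.
  by rewrite gtr0_norm.
have g0 y : 0 <= g y by rewrite le_max lexx.
have mg : measurable_fun D g.
  apply: measurable_maxr; first exact: measurable_cst.
  apply: measurable_funB; first exact: measurable_cst.
  by apply: measurable_funTS; apply: measurableT_comp => //; exact: measurable_ln.
have gu : {ae mu, forall y, D y -> ((g y)%:E <= u y)%E}.
  apply: filterS wpos => y wy Dy.
  have exn : exists n, t / L ^+ n <= w y.
    (* Some power of [L] is at least 2; its powers in turn exceed [t / w y]. *)
    have [|n hn] := @exists_exprn_le_half R L^-1; first by rewrite invr_ge0 ltW//= invf_lt1.
    have [k hk] := exists_pow2_ge t wy.
    exists (n * k)%N; rewrite ler_pdivrMr ?exprn_gt0//.
    rewrite mulrC; apply: le_trans hk _; rewrite ler_pM2r// exprM.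
    apply: lerXn2r; rewrite ?nnegrE ?exprn_ge0 ?(ltW L0)//.
    by move: hn; rewrite exprVn lef_pV2 ?posrE ?exprn_gt0.
  (* By minimality the first [n] levels all exceed [w y], so [u y] is at least [n * ln L], which is
     at least [ln t - ln (w y)]. *)
  case: (ex_minnP exn) => n hn minn.
  apply: (@le_trans _ _ (\sum_(0 <= i < n) f i y)%E); last first.
    by apply: nneseries_lim_ge => i _ _; exact: f0.
  rewrite (eq_big_nat _ _ (F2 := fun=> (ln L)%:E)); last first.
    move=> i /andP[_ im]; rewrite /f indicE mem_set ?mulr1//=.
    by rewrite /S /= ltNge; apply/negP => /minn; rewrite leqNgt im.
  rewrite sumEFin lee_fin sumr_const_nat subn0 /g ge_max mulrn_wge0 ?(ltW lL0)//=.
  rewrite lerBlDl -lnXn// -lnM ?posrE ?exprn_gt0// ler_ln ?posrE ?mulr_gt0 ?exprn_gt0//.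
  by rewrite -ler_pdivrMr ?exprn_gt0.
have gi : (\int[mu]_(y in D) (g y)%:E <= (ln L * V / (1 - theta))%:E)%E.
  apply: le_trans intu; apply: ae_ge0_le_integral => //.
  - by move=> y _; rewrite lee_fin.
  - exact/measurable_EFinP.
have gint : mu.-integrable D (EFin \o g).
  apply/integrableP; split; first exact/measurable_EFinP.
  under eq_integral do rewrite gee0_abs ?lee_fin//.
  by apply: le_lt_trans gi _; rewrite ltry.
by split=> //; rewrite -lee_fin fineK// integrable_fin_num.
Qed.

(** * Logarithms of reverse Hoelder weights *)

Section reverse_holder_infinity.
Context {R : realType} {X : completeMetricType R}.
Variable mu : {measure set (borelType X) -> \bar R}.

(** Sublevel decay bounds the mean deficit of [log w] below [ln (c * mean mu w x r)], hence the mean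
    of [log w] from below; reverse Hoelder bounds its essential supremum from above. *)
Lemma RHinfty_BUO (w : X -> R) : doubling mu -> annular_decay mu ->
  RHinfty mu w -> BUO mu (log w).
Proof.
move=> [Cd Cd1 dbl] [alpha [Ca [al Ca1 ann]]] [ww [C hC]].
have [w0 wL _] := ww; have wpos := weight_gt0_ae ww.
have mw := L1loc_measurable Cd1 dbl wL.
have iw (x : X) (r : R) := L1loc_ball Cd1 dbl x r wL.
pose CR := Num.max 1 C.
have CR1 : 1 <= CR by rewrite le_max lexx.
have CR0 : 0 < CR by exact: lt_le_trans CR1.
have RH (x : X) (r : R) : 0 < r -> {ae mu, forall y : borelType X, ball x r y ->
    w y <= CR * (mass mu w (ball x r) / vol mu (ball x r))}.
  move=> r0; have := hC x r r0; rewrite (avgE Cd1 dbl)// -EFinM => /ess_sup_ballP.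
  apply: filterS => y /[apply]; rewrite lee_fin => /le_trans; apply.
  rewrite ler_pM2r; first by rewrite le_max lexx orbT.
  exact: (mean_weight_gt0 Cd1 dbl x r0 ww).
have [D D1 massD] := mass_double Cd1 dbl w0 mw iw CR1 RH al Ca1 ann.
have [c [L [theta [c0 L1 th01 decay]]]] :=
  sublevel_decay Cd1 dbl w0 mw iw wpos CR1 RH D1 massD.
(* The layer-cake bound with [V = Cd * vol mu (ball x r)], divided by the volume of the ball. *)
pose K := ln L * Cd / (1 - theta).
have deficit (x : X) (r : R) : 0 < r ->
    let g y := Num.max 0 (ln (c * mean mu w x r) - ln (w y)) in
    mu.-integrable (ball x r) (EFin \o g) /\ mean mu g x r <= K.
  move=> r0 g; have a0 := mean_weight_gt0 Cd1 dbl x r0 ww.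
  have v0 := vol_ball_gt0 Cd1 dbl x r0.
  have [||i|gi gK] := @log_deficit_integrable _ (borelType X) R mu (ball x r) w
    (c * mean mu w x r) L theta (Cd * vol mu (ball x r))
    (measurable_mball x r) mw wpos _ L1 th01.
  - exact: mulr_gt0.
  - by rewrite mulr_ge0 ?vol_ge0// ltW// (lt_trans _ Cd1).
  - rewrite (volE Cd1 dbl _ (_ : _ `<=` ball x r)); last by move=> y [].
      by rewrite lee_fin; exact: decay.
    apply: measurableI; first exact: measurable_mball.
    exact: (measurable_sublevel mw).
  split=> //; rewrite /mean ler_pdivrMr//; apply: (le_trans gK).
  by rewrite /K; lra.
have lL : L1loc mu (log w).
  apply: (L1loc_log Cd1 dbl ww) => x r r0; have [gi _] := deficit x r r0.
  set g := (fun y => Num.max 0 _) in gi.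
  exists (fun y => 1 * g y + (- ln (c * mean mu w x r))).
    exact: (@integrable_affine _ (borelType X) R mu _ (measurable_mball x r)
      (mu_ball_lty Cd1 dbl x r) g 1 _ gi).
  apply: aeW => y _; rewrite mul1r /g -lerBlDr opprK addrC.
  by rewrite le_max lexx orbT.
(* The difference of the upper bound [ln CR + ln (mean mu w x r)] for [log w] and the lower bound
   [ln c + ln (mean mu w x r) - K] for its mean. *)
split=> //; apply: (@le_lt_trans _ _ (ln CR - ln c + K)%:E); last exact: ltry.
apply: ge_ereal_sup => _ [x [r [r0 ->]]].
have a0 := mean_weight_gt0 Cd1 dbl x r0 ww.
rewrite (avgE Cd1 dbl)// -/(mean mu (log w) x r).
have [gi gK] := deficit x r r0; set g := (fun y => Num.max 0 _) in gi gK.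
have low : ln (c * mean mu w x r) - K <= mean mu (log w) x r.
  apply: (@le_trans _ _ (-1 * mean mu g x r + ln (c * mean mu w x r))); first by lra.
  rewrite -(mean_affine Cd1 dbl)//; apply: (le_mean Cd1 dbl) => //.
  - exact: (@integrable_affine _ (borelType X) R mu _ (measurable_mball x r)
      (mu_ball_lty Cd1 dbl x r) g _ _ gi).
  - exact: (L1loc_ball Cd1 dbl x r lL).
  - apply: aeW => y _; have : ln (c * mean mu w x r) - ln (w y) <= g y.
      by rewrite le_max lexx orbT.
    rewrite /log; lra.
have up : (ess_sup_ball mu x r (log w) <= (ln (CR * mean mu w x r))%:E)%E.
  apply/ess_sup_ballP; apply: filterS2 wpos (RH x r r0) => y wy + xy.
  move=> /(_ xy) wM; rewrite lee_fin ler_ln ?posrE//.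
  exact: mulr_gt0.
apply: (@le_trans _ _ ((ln (CR * mean mu w x r))%:E - (mean mu (log w) x r)%:E)%E).
  by rewrite leeB.
rewrite -EFinB lee_fin lnM ?posrE//; move: low; rewrite lnM ?posrE//.
lra.
Qed.

End reverse_holder_infinity.

Theorem theorem1p1 (R : realType) (X : completeMetricType R)
    (mu : {measure set (borelType X) -> \bar R}) :
  doubling mu -> annular_decay mu ->
  A1 mu = [set w | Ainfty mu w /\ BLO mu (log w)] /\
  RHinfty mu = [set w | weight mu w /\ BUO mu (log w)].
Proof.
move=> dbl ann; have [Cd Cd1 dblC] := dbl.
split; first exact: (A1_characterization Cd1 dblC).
apply/seteqP; split=> w [].
- by move=> ww hC; split=> //; apply: RHinfty_BUO.
- exact: (BUO_RHinfty Cd1 dblC).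
Qed.
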